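(* Suppose $\mathcal{C}$ is a braided strict monoidal category, $\mathcal{M}$ is a balanced strict monoidal category with braiding $\beta$ and twist $\theta$, and $F\colon\mathcal{C}\to\mathcal{M}$ is a braided monoidal functor. Then there is an action of the strict monoidal category $\mathrm{Aff}(\mathcal{C})$ on $\mathcal{M}$ uniquely determined by $$X\cdot M:=F(X)\otimes M,\qquad f\cdot g:=F(f)\otimes g,$$ $$\xi_X\cdot g:=\beta_{N,F(X)}\circ(g\otimes\theta_{F(X)})\circ\beta_{F(X),M},\qquad \xi_X^{-1}\cdot g:=\beta_{F(X),N}^{-1}\circ(g\otimes\theta_{F(X)}^{-1})\circ\beta_{M,F(X)}^{-1},$$ for all objects $X$ of $\mathcal{C}$ (equivalently, of $\mathrm{Aff}(\mathcal{C})$), all morphisms $f$ of $\mathcal{C}$, all objects $M,N$ of $\mathcal{M}$ and all $g\in\mathrm{Hom}_{\mathcal{M}}(M,N)$.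
   Context: All categories are essentially small. ''Monoidal functor'' means strong monoidal functor. $\mathbf{1}$ is the unit object. Affinization: for a strict monoidal category $\mathcal{C}$, $\mathrm{Aff}(\mathcal{C})$ is the category with the same objects as $\mathcal{C}$, obtained from $\mathcal{C}$ by adjoining (under composition) invertible morphisms $\xi_{X,Y}\colon X\otimes Y\to Y\otimes X$ for all objects $X,Y$, subject to $$\xi_{X,Y\otimes Z}=\xi_{Z\otimes X,Y}\circ\xi_{X\otimes Y,Z},\qquad \xi_{X_2,Y_2}\circ(g\otimes f)=(f\otimes g)\circ\xi_{X_1,Y_1}$$ for all objects $X,X_1,X_2,Y,Y_1,Y_2,Z$ and all $f\in\mathrm{Hom}_{\mathcal{C}}(Y_1,Y_2)$, $g\in\mathrm{Hom}_{\mathcal{C}}(X_1,X_2)$. Put $\xi_X:=\xi_{\mathbf{1},X}\colon X\to X$. If $\mathcal{C}$ is braided with braiding $\beta$ (convention $\beta_{X,Y\otimes Z}=(1_Y\otimes\beta_{X,Z})\circ(\beta_{X,Y}\otimes 1_Z)$, $\beta_{X\otimes Y,Z}=(\beta_{X,Z}\otimes 1_Y)\circ(1_X\otimes\beta_{Y,Z})$), $\mathrm{Aff}(\mathcal{C})$ is a strict monoidal category with the unique tensor product extending that of $\mathcal{C}$ such that $\xi_{X,Y}\otimes 1_Z=\xi_{X\otimes Z,Y}\circ(1_X\otimes\beta_{Y,Z})$ and $1_X\otimes\xi_{Y,Z}=(\beta_{X,Z}^{-1}\otimes 1_Y)\circ\xi_{X\otimes Y,Z}$. Balanced: a strict monoidal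 category is balanced if it is braided and has a twist, i.e. a natural isomorphism $\theta$ from the identity functor to itself with $\theta_{\mathbf{1}}=1_{\mathbf{1}}$ and $\theta_{X\otimes Y}=\beta_{Y,X}\circ(\theta_Y\otimes\theta_X)\circ\beta_{X,Y}$. Action: an action of a strict monoidal category $\mathcal{D}$ on a category $\mathcal{M}$ is a monoidal functor $A\colon\mathcal{D}\to\mathrm{End}(\mathcal{M})$, where $\mathrm{End}(\mathcal{M})$ is the strict monoidal category of endofunctors of $\mathcal{M}$ and natural transformations. One writes $X\cdot M=A(X)(M)$, and for $f\colon X\to Y$ in $\mathcal{D}$ and $g\colon M\to N$ in $\mathcal{M}$, $f\cdot g=A(f)_N\circ A(X)(g)\colon X\cdot M\to Y\cdot N$. The action of $\mathrm{Aff}(\mathcal{C})$ extends the action of $\mathcal{C}$ on $\mathcal{M}$ given by $X\cdot M=F(X)\otimes M$, $f\cdot g=F(f)\otimes g$, whose monoidal structure isomorphisms are those induced by $F$. *)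

(* Defs.v *)
From HB Require Import structures.
From mathcomp Require Import all_boot boolp.

Set Implicit Arguments.
Unset Strict Implicit.
Unset Printing Implicit Defensive.

Declare Scope cat_scope.
Delimit Scope cat_scope with cat.
Local Open Scope cat_scope.

Reserved Notation "g ∘ f" (at level 40, left associativity).
Reserved Notation "X ⊗ Y" (at level 38, left associativity).
Reserved Notation "f ⊠ g" (at level 38, left associativity).
Reserved Notation "f ≡ g" (at level 70, no associativity).
Reserved Notation "g ⋆ f" (at level 40, left associativity).

Record category := Category {
  Ob :> Type;
  Hom : Ob -> Ob -> Type;
  idm : forall X, Hom X X;
  comp : forall X Y Z, Hom Y Z -> Hom X Y -> Hom X Z;
  comp_idl : forall X Y (f : Hom X Y), comp (idm Y) f = f;
  comp_idr : forall X Y (f : Hom X Y), comp f (idm X) = f;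
  compA : forall W X Y Z (h : Hom Y Z) (g : Hom X Y) (f : Hom W X),
    comp h (comp g f) = comp (comp h g) f }.

Arguments Hom {c} X Y.
Arguments idm {c} X.
Arguments comp {c X Y Z} g f.
Notation "g ∘ f" := (comp g f) : cat_scope.

Record iso (C : category) (X Y : C) := Iso {
  iso_hom :> Hom X Y;
  iso_inv : Hom Y X;
  iso_homK : iso_inv ∘ iso_hom = idm X;
  iso_invK : iso_hom ∘ iso_inv = idm Y }.

Notation "i ^-1" := (iso_inv i) : cat_scope.

(** Strictness is an equality of objects, so both sides of an equation between
    morphisms may have endpoints that are only provably equal.  [f ≡ g] says
    that [f] and [g] are the same morphism, i.e. they have the same source, the
    same target, and are equal; [eqhom e] is the identity of [X] seen as a
    morphism from [X] to [Y], along an equality [e : X = Y]. *)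
Record arrow (C : category) := Arrow {
  asrc : C;
  atgt : C;
  ahom : Hom asrc atgt }.

Arguments Arrow {C asrc atgt} ahom.
Notation "f ≡ g" := (Arrow f = Arrow g) : cat_scope.

Definition eqhom (C : category) (X Y : C) (e : X = Y) : Hom X Y :=
  match e in _ = Z return Hom X Z with erefl => idm X end.

Lemma Arrow_inj (C : category) (X Y : C) (f g : Hom X Y) : f ≡ g -> f = g.
Proof.
move=> efg.
have [e1 [e2]] : exists (e1 : asrc (Arrow f) = asrc (Arrow g))
    (e2 : atgt (Arrow f) = atgt (Arrow g)),
    eqhom e2 ∘ ahom (Arrow f) = ahom (Arrow g) ∘ eqhom e1.
  rewrite -efg; exists erefl, erefl => /=.
  by rewrite comp_idl comp_idr.
rewrite /= in e1 e2 *.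
by rewrite (Prop_irrelevance e1 erefl) (Prop_irrelevance e2 erefl) /=
  comp_idl comp_idr.
Qed.

Lemma iso_cast_subproof (C : category) (X X' Y Y' : C)
    (eX : X = X') (eY : Y = Y') (f : Hom X Y) (g : Hom Y X) :
  g ∘ f = idm X ->
  (eqhom eX ∘ g ∘ eqhom (esym eY)) ∘ (eqhom eY ∘ f ∘ eqhom (esym eX)) = idm X'.
Proof.
by move=> gfK; case: _ / eX; case: _ / eY; rewrite /= !comp_idl !comp_idr.
Qed.

Definition iso_cast (C : category) (X X' Y Y' : C) (eX : X = X') (eY : Y = Y')
    (i : iso X Y) : iso X' Y' :=
  Iso (iso_cast_subproof eX eY (iso_homK i))
      (iso_cast_subproof eY eX (iso_invK i)).

Definition iso_id (C : category) (X : C) : iso X X :=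
  Iso (comp_idl (idm X)) (comp_idl (idm X)).

Definition iso_sym (C : category) (X Y : C) (i : iso X Y) : iso Y X :=
  Iso (iso_invK i) (iso_homK i).

Lemma iso_comp_subproof (C : category) (X Y Z : C) (j : Hom Y Z) (j' : Hom Z Y)
    (i : Hom X Y) (i' : Hom Y X) :
  j' ∘ j = idm Y -> i' ∘ i = idm X -> (i' ∘ j') ∘ (j ∘ i) = idm X.
Proof. by move=> jK iK; rewrite !compA -[i' ∘ _ ∘ _]compA jK comp_idr. Qed.

Definition iso_comp (C : category) (X Y Z : C) (j : iso Y Z) (i : iso X Y) :
    iso X Z :=
  Iso (iso_comp_subproof (iso_homK j) (iso_homK i))
      (iso_comp_subproof (iso_invK i) (iso_invK j)).

Record functor (C D : category) := Functor {
  fobj :> C -> D;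
  fmap : forall X Y : C, Hom X Y -> Hom (fobj X) (fobj Y);
  fmap_id : forall X : C, fmap (idm X) = idm (fobj X);
  fmap_comp : forall (X Y Z : C) (g : Hom Y Z) (f : Hom X Y),
    fmap (g ∘ f) = fmap g ∘ fmap f }.

Arguments fmap {C D} f {X Y} _ : rename.

Lemma fid_comp (C : category) (X Y Z : C) (g : Hom Y Z) (f : Hom X Y) :
  g ∘ f = g ∘ f.
Proof. by []. Qed.

Definition fid (C : category) : functor C C :=
  @Functor C C (fun X => X) (fun X Y f => f) (fun X => erefl) (@fid_comp C).

Lemma fcomp_id (C D E : category) (G : functor D E) (F : functor C D) (X : C) :
  fmap G (fmap F (idm X)) = idm (G (F X)).
Proof. by rewrite !fmap_id. Qed.

Lemma fcomp_comp (C D E : category) (G : functor D E) (F : functor C D)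
    (X Y Z : C) (g : Hom Y Z) (f : Hom X Y) :
  fmap G (fmap F (g ∘ f)) = fmap G (fmap F g) ∘ fmap G (fmap F f).
Proof. by rewrite !fmap_comp. Qed.

Definition fcomp (C D E : category) (G : functor D E) (F : functor C D) :
    functor C E :=
  @Functor C E (fun X => G (F X)) (fun X Y f => fmap G (fmap F f))
    (fcomp_id G F) (fcomp_comp G F).

Lemma functor_eq (C D : category) (F G : functor C D)
    (e : forall X, F X = G X) :
  (forall (X Y : C) (f : Hom X Y), fmap F f ≡ fmap G f) -> F = G.
Proof.
case: F G e => [F Ff F1 Fc] [G Gf G1 Gc] /= /funext e; case: _ / e Gf G1 Gc.
move=> Gf G1 Gc E.
have e : Ff = Gf.
  by apply: functional_extensionality_dep => X;
     apply: functional_extensionality_dep => Y; apply: funext => f;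
     apply: Arrow_inj.
by case: _ / e G1 Gc {E} => G1 Gc; congr Functor; apply: Prop_irrelevance.
Qed.

Lemma iso_fmap_subproof (C D : category) (F : functor C D) (X Y : C)
    (f : Hom X Y) (g : Hom Y X) :
  g ∘ f = idm X -> fmap F g ∘ fmap F f = idm (F X).
Proof. by move=> gfK; rewrite -fmap_comp gfK fmap_id. Qed.

Definition iso_fmap (C D : category) (F : functor C D) (X Y : C)
    (i : iso X Y) : iso (F X) (F Y) :=
  Iso (iso_fmap_subproof F (iso_homK i)) (iso_fmap_subproof F (iso_invK i)).

Record nattrans (C D : category) (F G : functor C D) := NatTrans {
  ncomp :> forall X : C, Hom (F X) (G X);
  ncomp_nat : forall (X Y : C) (f : Hom X Y),
    ncomp Y ∘ fmap F f = fmap G f ∘ ncomp X }.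

Lemma nattrans_eq (C D : category) (F G : functor C D) (a b : nattrans F G) :
  (forall X, a X = b X) -> a = b.
Proof.
case: a b => [a an] [b bn] /= E.
have e : a = b by apply: functional_extensionality_dep.
by case: _ / e bn {E} => bn; congr NatTrans; apply: Prop_irrelevance.
Qed.

Record strict_monoidal := StrictMonoidal {
  sm_cat :> category;
  tens : sm_cat -> sm_cat -> sm_cat;
  unit_ob : sm_cat;
  tensm : forall X X' Y Y' : sm_cat,
    Hom X X' -> Hom Y Y' -> Hom (tens X Y) (tens X' Y');
  tensm_id : forall X Y : sm_cat, tensm (idm X) (idm Y) = idm (tens X Y);
  tensm_comp : forall (X X' X'' Y Y' Y'' : sm_cat)
      (f' : Hom X' X'') (f : Hom X X') (g' : Hom Y' Y'') (g : Hom Y Y'),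
    tensm (f' ∘ f) (g' ∘ g) = tensm f' g' ∘ tensm f g;
  tensA : forall X Y Z, tens (tens X Y) Z = tens X (tens Y Z);
  tens1o : forall X, tens unit_ob X = X;
  tenso1 : forall X, tens X unit_ob = X;
  tensmA : forall (X X' Y Y' Z Z' : sm_cat)
      (f : Hom X X') (g : Hom Y Y') (h : Hom Z Z'),
    tensm (tensm f g) h ≡ tensm f (tensm g h);
  tensm1o : forall (X X' : sm_cat) (f : Hom X X'), tensm (idm unit_ob) f ≡ f;
  tensmo1 : forall (X X' : sm_cat) (f : Hom X X'), tensm f (idm unit_ob) ≡ f }.

Arguments unit_ob {s}.
Arguments tensm {s X X' Y Y'} f g.
Notation "X ⊗ Y" := (tens X Y) : cat_scope.
Notation "f ⊠ g" := (tensm f g) : cat_scope.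
Notation "𝟙" := unit_ob : cat_scope.

Lemma iso_tens_subproof (C : strict_monoidal) (X X' Y Y' : C)
    (f : Hom X X') (f' : Hom X' X) (g : Hom Y Y') (g' : Hom Y' Y) :
  f' ∘ f = idm X -> g' ∘ g = idm Y ->
  (f' ⊠ g') ∘ (f ⊠ g) = idm (X ⊗ Y).
Proof. by move=> fK gK; rewrite -tensm_comp fK gK tensm_id. Qed.

Definition iso_tens (C : strict_monoidal) (X X' Y Y' : C)
    (i : iso X X') (j : iso Y Y') : iso (X ⊗ Y) (X' ⊗ Y') :=
  Iso (iso_tens_subproof (iso_homK i) (iso_homK j))
      (iso_tens_subproof (iso_invK i) (iso_invK j)).

Record braided := Braided {
  br_sm :> strict_monoidal;
  braid : forall X Y : br_sm, iso (X ⊗ Y) (Y ⊗ X);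
  braid_nat : forall (X X' Y Y' : br_sm) (f : Hom X X') (g : Hom Y Y'),
    braid X' Y' ∘ (f ⊠ g) = (g ⊠ f) ∘ braid X Y;
  braid_tensr : forall X Y Z : br_sm,
    braid X (Y ⊗ Z) ≡
      (idm Y ⊠ braid X Z) ∘ eqhom (tensA Y X Z) ∘ (braid X Y ⊠ idm Z);
  braid_tensl : forall X Y Z : br_sm,
    braid (X ⊗ Y) Z ≡
      (braid X Z ⊠ idm Y) ∘ eqhom (esym (tensA X Z Y)) ∘ (idm X ⊠ braid Y Z) }.

Record balanced := Balanced {
  bal_br :> braided;
  twist : forall X : bal_br, iso X X;
  twist_nat : forall (X Y : bal_br) (f : Hom X Y),
    twist Y ∘ f = f ∘ twist X;
  twist_unit : (twist 𝟙 : Hom 𝟙 𝟙) = idm 𝟙;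
  twist_tens : forall X Y : bal_br,
    (twist (X ⊗ Y) : Hom (X ⊗ Y) (X ⊗ Y)) =
      braid Y X ∘ (twist Y ⊠ twist X) ∘ braid X Y }.

Record monoidal_functor (C D : strict_monoidal) := MonoidalFunctor {
  mf_fun :> functor C D;
  mu : forall X Y : C, iso (mf_fun X ⊗ mf_fun Y) (mf_fun (X ⊗ Y));
  eta : iso 𝟙 (mf_fun 𝟙);
  mu_nat : forall (X X' Y Y' : C) (f : Hom X X') (g : Hom Y Y'),
    mu X' Y' ∘ (fmap mf_fun f ⊠ fmap mf_fun g) = fmap mf_fun (f ⊠ g) ∘ mu X Y;
  mu_assoc : forall X Y Z : C,
    mu (X ⊗ Y) Z ∘ (mu X Y ⊠ idm (mf_fun Z)) ≡
      mu X (Y ⊗ Z) ∘ (idm (mf_fun X) ⊠ mu Y Z);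
  mu_unitl : forall X : C,
    mu 𝟙 X ∘ (eta ⊠ idm (mf_fun X)) ≡ idm (mf_fun X);
  mu_unitr : forall X : C,
    mu X 𝟙 ∘ (idm (mf_fun X) ⊠ eta) ≡ idm (mf_fun X) }.

Arguments mu {C D} F X Y : rename.
Arguments eta {C D} F : rename.

Record braided_functor (C D : braided) := BraidedFunctor {
  bf_mf :> monoidal_functor C D;
  bf_braid : forall X Y : C,
    fmap bf_mf (braid X Y) ∘ mu bf_mf X Y =
      mu bf_mf Y X ∘ braid (bf_mf X) (bf_mf Y) }.

(** On [arrow C] the tensor product is total and strictly associative, and
    composition is made total by a junk value. *)

Section Arrows.
Variable C : category.
Implicit Types a b c : arrow C.

Lemma arrowP a b (e1 : asrc a = asrc b) (e2 : atgt a = atgt b) :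
  eqhom e2 ∘ ahom a = ahom b ∘ eqhom e1 -> a = b.
Proof.
case: a b e1 e2 => [X Y f] [X' Y' g] /= e1 e2; case: _ / e1 g => g.
by case: _ / e2 g => g /=; rewrite comp_idl comp_idr => ->.
Qed.

Definition aid (X : C) := Arrow (idm X).

Lemma Arrow_eqhom (X Y : C) (e : X = Y) : Arrow (eqhom e) = aid X.
Proof. by case: _ / e. Qed.

Definition acomp (b a : arrow C) : arrow C :=
  if pselect (atgt a = asrc b) is left e
  then Arrow (ahom b ∘ (eqhom e ∘ ahom a)) else b.

Local Notation "b ⋆ a" := (acomp b a).

Lemma Arrow_comp (X Y Z : C) (g : Hom Y Z) (f : Hom X Y) :
  Arrow (g ∘ f) = Arrow g ⋆ Arrow f.
Proof.
rewrite /acomp; case: pselect => [e|[]//=].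
by rewrite (Prop_irrelevance e erefl) /= comp_idl.
Qed.

Lemma atgt_comp b a : atgt (b ⋆ a) = atgt b.
Proof. by rewrite /acomp; case: pselect. Qed.

Lemma asrc_comp b a : atgt a = asrc b -> asrc (b ⋆ a) = asrc a.
Proof. by rewrite /acomp; case: pselect. Qed.

Lemma acomp_idl a X : X = atgt a -> aid X ⋆ a = a.
Proof.
by move=> ->; case: a => X' Y f; rewrite /aid -Arrow_comp /= comp_idl.
Qed.

Lemma acomp_idr a X : X = asrc a -> a ⋆ aid X = a.
Proof.
by move=> ->; case: a => X' Y f; rewrite /aid -Arrow_comp /= comp_idr.
Qed.

Lemma acompA c b a : atgt a = asrc b -> atgt b = asrc c ->
  c ⋆ b ⋆ a = c ⋆ (b ⋆ a).
Proof.
case: a b c => [X Y f] [X' Y' g] [X'' Y'' h] /= e1 e2.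
case: _ / e1 g => g; case: _ / e2 h => h.
by rewrite -!Arrow_comp compA.
Qed.

Lemma acompA_eq c b a d : b ⋆ a = d -> atgt a = asrc b -> atgt b = asrc c ->
  c ⋆ b ⋆ a = c ⋆ d.
Proof. by move=> <-; apply: acompA. Qed.

End Arrows.

Notation "b ⋆ a" := (acomp b a) : cat_scope.

Section InverseArrows.
Variable C : category.
Implicit Types a b c f g p q : arrow C.

Definition ainv a b :=
  [/\ atgt a = asrc b, atgt b = asrc a,
      b ⋆ a = aid (asrc a) & a ⋆ b = aid (asrc b)].

Lemma ainv_iso (X Y : C) (i : iso X Y) : ainv (Arrow i) (Arrow i^-1).
Proof.
by split=> //; rewrite -Arrow_comp ?iso_homK ?iso_invK.
Qed.

Lemma ainv_sym a b : ainv a b -> ainv b a.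
Proof. by case. Qed.

Lemma ainv_square f p q g f' g' : ainv f f' -> ainv g g' ->
  atgt p = asrc f -> atgt g = asrc q -> asrc p = asrc g -> atgt f = atgt q ->
  f ⋆ p = q ⋆ g -> p ⋆ g' = f' ⋆ q.
Proof.
move=> [f1 f2 f3 f4] [g1 g2 g3 g4] pf gq pg fq E.
rewrite -[p](@acomp_idl _ _ (asrc f)) // -f3 (@acompA _ f') // E.
have e1 : atgt g' = asrc (q ⋆ g) by rewrite asrc_comp // g2.
have e2 : atgt (q ⋆ g) = asrc f' by rewrite atgt_comp -fq f1.
rewrite (acompA e1 e2) (acompA _ gq) ?g4 //.
by rewrite (@acomp_idr _ q) // -g1 gq.
Qed.

Lemma ainv_uniq a b c : ainv a b -> ainv a c -> b = c.
Proof.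
move=> [a1 a2 a3 a4] [b1 b2 b3 b4].
rewrite -[b](@acomp_idr _ _ (asrc c)) -?b1 //.
by rewrite b1 -b4 -acompA ?a3 ?acomp_idl // -?b1.
Qed.

Lemma acomp_square b a d c r : b ⋆ a = d ⋆ c ->
  atgt a = asrc b -> atgt c = asrc d -> atgt r = asrc a -> atgt r = asrc c ->
  b ⋆ (a ⋆ r) = d ⋆ (c ⋆ r).
Proof. by move=> E *; rewrite -!acompA // E. Qed.

End InverseArrows.

Section FunctorArrows.
Variables (C D : category) (F : functor C D).

Definition afmap (a : arrow C) : arrow D := Arrow (fmap F (ahom a)).

Lemma afmap_comp b a : atgt a = asrc b -> afmap (b ⋆ a) = afmap b ⋆ afmap a.
Proof.
case: a b => [X Y f] [Y' Z g] /= e; case: _ / e g => g.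
by rewrite -Arrow_comp /afmap /= fmap_comp Arrow_comp.
Qed.

Lemma afmap_id X : afmap (aid X) = aid (F X).
Proof. by rewrite /afmap /= fmap_id. Qed.

Lemma afmap_inv a b : ainv a b -> ainv (afmap a) (afmap b).
Proof.
move=> [e1 e2 e3 e4]; split; rewrite /= ?e1 ?e2 //.
  by rewrite -afmap_comp // e3 afmap_id.
by rewrite -afmap_comp // e4 afmap_id.
Qed.

End FunctorArrows.

Lemma Arrow_iso_cast (C : category) (X X' Y Y' : C) (eX : X = X') (eY : Y = Y')
  (i : iso X Y) : Arrow (iso_cast eX eY i) = Arrow i.
Proof.
by case: _ / eX; case: _ / eY; rewrite /= comp_idl comp_idr.
Qed.

Section MonArrows.
Variable C : strict_monoidal.
Implicit Types a b c : arrow C.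

Definition atens a b : arrow C := Arrow (ahom a ⊠ ahom b).

Lemma Arrow_tens (X X' Y Y' : C) (f : Hom X X') (g : Hom Y Y') :
  Arrow (f ⊠ g) = atens (Arrow f) (Arrow g).
Proof. by []. Qed.

Lemma atensA a b c : atens (atens a b) c = atens a (atens b c).
Proof. exact: tensmA. Qed.

Lemma atens1o a : atens (aid 𝟙) a = a.
Proof. by case: a => X Y f; exact: tensm1o. Qed.

Lemma atenso1 a : atens a (aid 𝟙) = a.
Proof. by case: a => X Y f; exact: tensmo1. Qed.

Lemma atens_id (X Y : C) : atens (aid X) (aid Y) = aid (X ⊗ Y).
Proof. by rewrite /aid -Arrow_tens tensm_id. Qed.

Lemma atens_comp a' a b' b : atgt a = asrc a' -> atgt b = asrc b' ->
  atens (a' ⋆ a) (b' ⋆ b) = atens a' b' ⋆ atens a b.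
Proof.
case: a a' b b' => [X Y f] [X' Y' f'] [Z W g] [Z' W' g'] /= e1 e2.
case: _ / e1 f' => f'; case: _ / e2 g' => g'.
by rewrite -!Arrow_comp -!Arrow_tens tensm_comp ?Arrow_comp.
Qed.

End MonArrows.

Arguments atens {C} a b.

Ltac composable :=
  rewrite ?atgt_comp;
  repeat (rewrite asrc_comp; [| solve [composable]]);
  rewrite /= ?tensA ?tens1o ?tenso1; by [].

Section Affinization.
Variable C : strict_monoidal.

(** Hom-sets of the affinization are formal composites of morphisms of [C] and
    of the [ξ^{±1}], modulo the congruence generated by the category laws, the
    functoriality of the inclusion of [C] and the defining relations of [ξ]. *)
Inductive aff_term : C -> C -> Type :=
| aff_mor X Y of Hom X Y : aff_term X Y
| aff_comp X Y Z of aff_term Y Z & aff_term X Y : aff_term X Z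
| aff_xi X Y : aff_term (X ⊗ Y) (Y ⊗ X)
| aff_xi_inv X Y : aff_term (Y ⊗ X) (X ⊗ Y).

Local Notation "t ∙ s" := (aff_comp t s) (at level 40, left associativity).

Inductive aff_rel : forall X Y, aff_term X Y -> aff_term X Y -> Prop :=
| aff_refl X Y (t : aff_term X Y) : aff_rel t t
| aff_sym X Y (s t : aff_term X Y) : aff_rel s t -> aff_rel t s
| aff_trans X Y (s t u : aff_term X Y) :
    aff_rel s t -> aff_rel t u -> aff_rel s u
| aff_cong X Y Z (t t' : aff_term Y Z) (s s' : aff_term X Y) :
    aff_rel t t' -> aff_rel s s' -> aff_rel (t ∙ s) (t' ∙ s')
| aff_assoc W X Y Z (u : aff_term Y Z) (t : aff_term X Y) (s : aff_term W X) :
    aff_rel (u ∙ (t ∙ s)) (u ∙ t ∙ s)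
| aff_idl X Y (t : aff_term X Y) : aff_rel (aff_mor (idm Y) ∙ t) t
| aff_idr X Y (t : aff_term X Y) : aff_rel (t ∙ aff_mor (idm X)) t
| aff_mor_comp X Y Z (g : Hom Y Z) (f : Hom X Y) :
    aff_rel (aff_mor (g ∘ f)) (aff_mor g ∙ aff_mor f)
| aff_xiK X Y : aff_rel (aff_xi_inv X Y ∙ aff_xi X Y) (aff_mor (idm (X ⊗ Y)))
| aff_xiVK X Y : aff_rel (aff_xi X Y ∙ aff_xi_inv X Y) (aff_mor (idm (Y ⊗ X)))
| aff_xi_tens X Y Z :
    aff_rel (aff_xi X (Y ⊗ Z))
      (aff_mor (eqhom (esym (tensA Y Z X))) ∙ aff_xi (Z ⊗ X) Y
       ∙ aff_mor (eqhom (esym (tensA Z X Y))) ∙ aff_xi (X ⊗ Y) Z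
       ∙ aff_mor (eqhom (esym (tensA X Y Z))))
| aff_xi_nat X1 X2 Y1 Y2 (f : Hom Y1 Y2) (g : Hom X1 X2) :
    aff_rel (aff_xi X2 Y2 ∙ aff_mor (g ⊠ f)) (aff_mor (f ⊠ g) ∙ aff_xi X1 Y1).

HB.instance Definition _ X Y :=
  Choice.copy (aff_term X Y) {classic (aff_term X Y)}.

Definition aff_relb X Y (s t : aff_term X Y) : bool := `[< aff_rel s t >].

Lemma aff_relb_refl X Y : reflexive (@aff_relb X Y).
Proof. by move=> s; apply/asboolP/aff_refl. Qed.
Lemma aff_relb_sym X Y : symmetric (@aff_relb X Y).
Proof. by move=> s t; apply/asboolP/asboolP => /aff_sym. Qed.
Lemma aff_relb_trans X Y : transitive (@aff_relb X Y).
Proof.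
by move=> t s u /asboolP st /asboolP tu; apply/asboolP/(aff_trans st tu).
Qed.

Canonical aff_equiv X Y := EquivRel (@aff_relb X Y)
  (@aff_relb_refl X Y) (@aff_relb_sym X Y) (@aff_relb_trans X Y).

Definition aff_hom (X Y : C) : Type := {eq_quot aff_equiv X Y}%qT.

Definition aff_cls X Y (t : aff_term X Y) : aff_hom X Y :=
  (\pi_({eq_quot aff_equiv X Y}) t)%qT.
Definition aff_repr X Y (f : aff_hom X Y) : aff_term X Y :=
  @repr _ ({eq_quot aff_equiv X Y}%qT) f.

Lemma aff_reprK X Y (f : aff_hom X Y) : aff_cls (aff_repr f) = f.
Proof. exact: (@reprK _ ({eq_quot aff_equiv X Y}%qT) f). Qed.

Lemma aff_clsP X Y (s t : aff_term X Y) : aff_cls s = aff_cls t <-> aff_rel s t.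
Proof.
split=> [/(@eqmodP _ (aff_equiv X Y) s t)/asboolP//|st].
by apply/(@eqmodP _ (aff_equiv X Y) s t)/asboolP.
Qed.

Lemma aff_clsK X Y (t : aff_term X Y) : aff_rel (aff_repr (aff_cls t)) t.
Proof. by apply/aff_clsP; rewrite aff_reprK. Qed.

Definition aff_homcomp X Y Z (g : aff_hom Y Z) (f : aff_hom X Y) : aff_hom X Z :=
  aff_cls (aff_repr g ∙ aff_repr f).

Lemma aff_cls_comp X Y Z (t : aff_term Y Z) (s : aff_term X Y) :
  aff_cls (t ∙ s) = aff_homcomp (aff_cls t) (aff_cls s).
Proof. by apply/aff_clsP/aff_sym/aff_cong; apply: aff_clsK. Qed.

Lemma aff_homcomp_idl X Y (f : aff_hom X Y) :
  aff_homcomp (aff_cls (aff_mor (idm Y))) f = f.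
Proof.
by rewrite -{1}[f]aff_reprK -aff_cls_comp -[RHS]aff_reprK;
  apply/aff_clsP/aff_idl.
Qed.

Lemma aff_homcomp_idr X Y (f : aff_hom X Y) :
  aff_homcomp f (aff_cls (aff_mor (idm X))) = f.
Proof.
by rewrite -{1}[f]aff_reprK -aff_cls_comp -[RHS]aff_reprK;
  apply/aff_clsP/aff_idr.
Qed.

Lemma aff_homcompA W X Y Z
    (h : aff_hom Y Z) (g : aff_hom X Y) (f : aff_hom W X) :
  aff_homcomp h (aff_homcomp g f) = aff_homcomp (aff_homcomp h g) f.
Proof.
rewrite -[h]aff_reprK -[g]aff_reprK -[f]aff_reprK -!aff_cls_comp.
exact/aff_clsP/aff_assoc.
Qed.

Definition Aff_cat : category :=
  Category aff_homcomp_idl aff_homcomp_idr aff_homcompA.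

Definition aff_in (X Y : C) (f : Hom X Y) : @Hom Aff_cat X Y :=
  aff_cls (aff_mor f).

Lemma aff_xi_homK X Y :
  aff_homcomp (aff_cls (aff_xi_inv X Y)) (aff_cls (aff_xi X Y)) =
  aff_in (idm (X ⊗ Y)).
Proof. rewrite -aff_cls_comp; exact/aff_clsP/aff_xiK. Qed.

Lemma aff_xi_invK X Y :
  aff_homcomp (aff_cls (aff_xi X Y)) (aff_cls (aff_xi_inv X Y)) =
  aff_in (idm (Y ⊗ X)).
Proof. rewrite -aff_cls_comp; exact/aff_clsP/aff_xiVK. Qed.

Definition xi (X Y : C) : @iso Aff_cat (X ⊗ Y) (Y ⊗ X) :=
  @Iso Aff_cat (X ⊗ Y) (Y ⊗ X) _ _ (aff_xi_homK X Y) (aff_xi_invK X Y).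

Lemma aff_in_id (X : C) : aff_in (idm X) = @idm Aff_cat X.
Proof. by []. Qed.

Lemma aff_in_comp (X Y Z : C) (g : Hom Y Z) (f : Hom X Y) :
  aff_in (g ∘ f) = aff_in g ∘ aff_in f.
Proof. by rewrite /aff_in -[RHS]aff_cls_comp; apply/aff_clsP/aff_mor_comp. Qed.

Definition Aff_in : functor C Aff_cat := Functor aff_in_id aff_in_comp.

Lemma aff_in_eqhom (X Y : C) (e : X = Y) :
  aff_in (eqhom e) = @eqhom Aff_cat X Y e.
Proof. by case: _ / e. Qed.

Lemma xi_nat (X1 X2 Y1 Y2 : C) (f : Hom Y1 Y2) (g : Hom X1 X2) :
  xi X2 Y2 ∘ aff_in (g ⊠ f) = aff_in (f ⊠ g) ∘ xi X1 Y1.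
Proof.
rewrite /aff_in /= -[LHS]aff_cls_comp -[RHS]aff_cls_comp.
exact/aff_clsP/aff_xi_nat.
Qed.

Lemma xi_tens (X Y Z : C) :
  xi X (Y ⊗ Z) ≡
    xi (Z ⊗ X) Y ∘ @eqhom Aff_cat _ _ (esym (tensA Z X Y)) ∘ xi (X ⊗ Y) Z.
Proof.
rewrite /= (iffRL (aff_clsP _ _) (aff_xi_tens X Y Z)) !aff_cls_comp -!/(aff_in _) !aff_in_eqhom.
rewrite !(@Arrow_comp Aff_cat) !Arrow_eqhom.
rewrite acomp_idr ?asrc_comp ?atgt_comp //= ?asrc_comp ?tensA //=.
by rewrite (@acomp_idl Aff_cat) ?tensA.
Qed.

(** [ξ_X = ξ_{𝟙,X}], seen as an automorphism of [X]. *)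
Definition xi1 (X : C) : @iso Aff_cat X X :=
  @iso_cast Aff_cat _ _ _ _ (tens1o X) (tenso1 X) (xi 𝟙 X).

End Affinization.

Section AffLift.
Variables (C : strict_monoidal) (D : category) (F : functor C D).
Variable z : forall X Y : C, iso (F (X ⊗ Y)) (F (Y ⊗ X)).
Hypothesis z_tens : forall X Y Z : C,
  z X (Y ⊗ Z) ≡ z (Z ⊗ X) Y ∘ fmap F (eqhom (esym (tensA Z X Y))) ∘ z (X ⊗ Y) Z.
Hypothesis z_nat : forall (X1 X2 Y1 Y2 : C) (f : Hom Y1 Y2) (g : Hom X1 X2),
  z X2 Y2 ∘ fmap F (g ⊠ f) = fmap F (f ⊠ g) ∘ z X1 Y1.

Fixpoint aff_lift_term (X Y : C) (t : aff_term X Y) : Hom (F X) (F Y) :=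
  match t with
  | aff_mor _ _ f => fmap F f
  | aff_comp _ _ _ t s => aff_lift_term t ∘ aff_lift_term s
  | aff_xi X Y => z X Y
  | aff_xi_inv X Y => (z X Y)^-1
  end.

Lemma fmap_eqhom (X Y : C) (e : X = Y) :
  fmap F (eqhom e) = eqhom (congr1 F e).
Proof. by case: _ / e; rewrite /= fmap_id. Qed.

Lemma aff_lift_rel (X Y : C) (s t : aff_term X Y) :
  aff_rel s t -> aff_lift_term s = aff_lift_term t.
Proof.
elim=> {X Y s t} /=.
- by [].
- by move=> X Y s t _ ->.
- by move=> X Y s t u _ -> _.
- by move=> X Y Z t t' s s' _ -> _ ->.
- by move=> *; rewrite compA.
- by move=> *; rewrite fmap_id comp_idl.
- by move=> *; rewrite fmap_id comp_idr.
- by move=> *; rewrite fmap_comp.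
- by move=> X Y; rewrite fmap_id iso_homK.
- by move=> X Y; rewrite fmap_id iso_invK.
- move=> X Y Z; apply: Arrow_inj; rewrite z_tens !fmap_eqhom.
  rewrite !Arrow_comp !Arrow_eqhom.
  do 2![rewrite acomp_idr; last by composable].
  by rewrite acomp_idl ?acomp_idr //; composable.
- by move=> X1 X2 Y1 Y2 f g; rewrite z_nat.
Qed.

Definition aff_lift_hom (X Y : C) (f : @Hom (Aff_cat C) X Y) : Hom (F X) (F Y) :=
  aff_lift_term (aff_repr f).

Lemma aff_lift_cls (X Y : C) (t : aff_term X Y) :
  aff_lift_hom (aff_cls t) = aff_lift_term t.
Proof. by apply/aff_lift_rel/aff_clsK. Qed.

Lemma aff_lift_id (X : C) : aff_lift_hom (@idm (Aff_cat C) X) = idm (F X).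
Proof. by rewrite aff_lift_cls /= fmap_id. Qed.

Lemma aff_lift_comp (X Y Z : C)
    (g : @Hom (Aff_cat C) Y Z) (f : @Hom (Aff_cat C) X Y) :
  aff_lift_hom (g ∘ f) = aff_lift_hom g ∘ aff_lift_hom f.
Proof. exact: aff_lift_cls. Qed.

Definition aff_lift : functor (Aff_cat C) D :=
  @Functor (Aff_cat C) D F aff_lift_hom aff_lift_id aff_lift_comp.

Lemma aff_lift_in (X Y : C) (f : Hom X Y) : fmap aff_lift (aff_in f) = fmap F f.
Proof. exact: aff_lift_cls. Qed.

Lemma aff_lift_xi (X Y : C) : fmap aff_lift (xi X Y) = z X Y.
Proof. exact: aff_lift_cls. Qed.

End AffLift.

Section AffArrows.
Variable C : strict_monoidal.
Local Notation D := (Aff_cat C).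
Local Notation G := (afmap (Aff_in C)).

Definition axi (X Y : C) : arrow D := Arrow (xi X Y).

Lemma axi_tens (X Y Z : C) : axi X (Y ⊗ Z) = axi (Z ⊗ X) Y ⋆ axi (X ⊗ Y) Z.
Proof.
rewrite /axi xi_tens !Arrow_comp Arrow_eqhom acomp_idr //.
by rewrite /= tensA.
Qed.

Lemma axi_nat (a b : arrow C) :
  axi (atgt a) (atgt b) ⋆ G (atens a b) = G (atens b a) ⋆ axi (asrc a) (asrc b).
Proof. by rewrite /axi /afmap /= -!Arrow_comp xi_nat. Qed.

Lemma aff_arrow_ind (P : arrow D -> Prop) :
  (forall a, P (G a)) -> (forall X Y, P (axi X Y)) ->
  (forall a b, ainv a b -> P a -> P b) ->
  (forall b a, atgt a = asrc b -> P b -> P a -> P (b ⋆ a)) ->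
  forall a, P a.
Proof.
move=> PG Pxi Pinv Pcomp [X Y f]; rewrite -[f]aff_reprK.
elim: (aff_repr f) => {X Y f} [X Y f|X Y Z t IHt s IHs|X Y|X Y].
- exact: (PG (Arrow f)).
- by rewrite aff_cls_comp; have := Pcomp _ _ _ IHt IHs; rewrite -Arrow_comp; apply.
- exact: Pxi.
- by apply: Pinv (Pxi X Y); apply: ainv_iso (xi X Y).
Qed.

End AffArrows.

Section AffMonoidal.
Variable C : braided.
Local Notation D := (Aff_cat C).
Local Notation G := (afmap (Aff_in C)).

Local Definition abr (X Y : C) : arrow C := Arrow (braid X Y).
Local Definition abrV (X Y : C) : arrow C := Arrow (braid X Y)^-1.

Lemma abr_inv X Y : ainv (abr X Y) (abrV X Y).
Proof. exact: ainv_iso. Qed.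

Lemma abr_nat (a b : arrow C) :
  abr (atgt a) (atgt b) ⋆ atens a b = atens b a ⋆ abr (asrc a) (asrc b).
Proof. by rewrite /abr -!Arrow_comp braid_nat. Qed.

Lemma abr_tensr X Y Z :
  abr X (Y ⊗ Z) = atens (aid Y) (abr X Z) ⋆ atens (abr X Y) (aid Z).
Proof.
rewrite /abr braid_tensr !Arrow_comp Arrow_eqhom acomp_idr //.
by rewrite /= tensA.
Qed.

Lemma abr_tensl X Y Z :
  abr (X ⊗ Y) Z = atens (abr X Z) (aid Y) ⋆ atens (aid X) (abr Y Z).
Proof.
rewrite /abr braid_tensl !Arrow_comp Arrow_eqhom acomp_idr //.
by rewrite /= tensA.
Qed.

Lemma ainv_aid (X : C) : ainv (aid X) (aid X).
Proof. by split=> //; rewrite acomp_idl. Qed.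

Lemma ainv_tens (a a' b b' : arrow C) :
  ainv a a' -> ainv b b' -> ainv (atens a b) (atens a' b').
Proof.
move=> [a1 a2 a3 a4] [b1 b2 b3 b4]; split; rewrite /= ?a1 ?a2 ?b1 ?b2 //.
  by rewrite -atens_comp // a3 b3 atens_id.
by rewrite -atens_comp // a4 b4 atens_id.
Qed.

Lemma ainv_comp (E : category) (a a' b b' : arrow E) :
  ainv a a' -> ainv b b' -> atgt a = asrc b -> ainv (b ⋆ a) (a' ⋆ b').
Proof.
move=> [a1 a2 a3 a4] [b1 b2 b3 b4] ab.
have ba' : atgt b' = asrc a' by rewrite b2 -a1.
have e1 : asrc (b ⋆ a) = asrc a by rewrite asrc_comp.
have e2 : asrc (a' ⋆ b') = asrc b' by rewrite asrc_comp.
split; rewrite ?e1 ?e2 ?atgt_comp //.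
- rewrite acompA ?atgt_comp -?b1 // -(@acompA _ b') // b3 -ab acomp_idl //.
- rewrite acompA ?atgt_comp -?a2 ?e2 // -(@acompA _ a) // a4.
  by rewrite acomp_idl // -ba'.
Qed.

Lemma abrV_tensr X Y Z :
  abrV X (Y ⊗ Z) = atens (abrV X Y) (aid Z) ⋆ atens (aid Y) (abrV X Z).
Proof.
apply: ainv_uniq (abr_inv _ _) _; rewrite abr_tensr.
apply: ainv_comp; last by rewrite /= tensA.
- exact: ainv_tens (abr_inv _ _) (ainv_aid _).
- exact: ainv_tens (ainv_aid _) (abr_inv _ _).
Qed.

Lemma abrV_tensl X Y Z :
  abrV (X ⊗ Y) Z = atens (aid X) (abrV Y Z) ⋆ atens (abrV X Z) (aid Y).
Proof.
apply: ainv_uniq (abr_inv _ _) _; rewrite abr_tensl.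
apply: ainv_comp; last by rewrite /= tensA.
- exact: ainv_tens (ainv_aid _) (abr_inv _ _).
- exact: ainv_tens (abr_inv _ _) (ainv_aid _).
Qed.

Lemma ainv_idem (E : category) (a b : arrow E) :
  ainv a b -> atgt a = asrc a -> a ⋆ a = a -> a = aid (asrc a).
Proof.
move=> [a1 a2 a3 a4] aa E1; rewrite -a3 -{2}E1 -acompA // a3 acomp_idl //.
Qed.

Lemma abr_unitr X : abr X 𝟙 = aid X.
Proof.
have := ainv_idem (abr_inv X 𝟙); rewrite /= tens1o tenso1; apply=> //.
by have := abr_tensr X 𝟙 𝟙; rewrite atens1o atenso1 tenso1.
Qed.

Lemma abr_unitl X : abr 𝟙 X = aid X.
Proof.
have := ainv_idem (abr_inv 𝟙 X); rewrite /= tens1o tenso1; apply=> //.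
by have := abr_tensl 𝟙 𝟙 X; rewrite atens1o atenso1 tenso1.
Qed.

Lemma abrV_unitl X : abrV 𝟙 X = aid X.
Proof.
by apply: ainv_uniq (abr_inv _ _) _; rewrite abr_unitl; apply: ainv_aid.
Qed.

Lemma abrV_nat (a b : arrow C) :
  abrV (atgt a) (atgt b) ⋆ atens b a = atens a b ⋆ abrV (asrc a) (asrc b).
Proof.
by apply/esym/(ainv_square (abr_inv _ _) (abr_inv _ _))/abr_nat.
Qed.

Lemma rtens_id Z X : idm X ⊠ idm Z = idm (X ⊗ Z) :> @Hom C _ _.
Proof. exact: tensm_id. Qed.

Lemma rtens_comp Z (X Y W : C) (g : Hom Y W) (f : Hom X Y) :
  (g ∘ f) ⊠ idm Z = (g ⊠ idm Z) ∘ (f ⊠ idm Z).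
Proof. by rewrite -tensm_comp comp_idl. Qed.

Definition rtens (Z : C) : functor C C :=
  @Functor C C (fun X => X ⊗ Z) (fun X Y f => f ⊠ idm Z)
    (rtens_id Z) (rtens_comp Z).

Lemma ltens_comp Z (X Y W : C) (g : Hom Y W) (f : Hom X Y) :
  idm Z ⊠ (g ∘ f) = (idm Z ⊠ g) ∘ (idm Z ⊠ f).
Proof. by rewrite -tensm_comp comp_idl. Qed.

Definition ltens (Z : C) : functor C C :=
  @Functor C C (fun X => Z ⊗ X) (fun X Y f => idm Z ⊠ f)
    (tensm_id Z) (ltens_comp Z).

(** [ξ_{X,Y} ⊗ 1_Z = ξ_{X⊗Z,Y} ∘ (1_X ⊗ β_{Y,Z})] *)
Definition xi_r (Z X Y : C) : @iso D (X ⊗ Y ⊗ Z) (Y ⊗ X ⊗ Z) :=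
  @iso_cast D _ _ _ _ (esym (tensA X Y Z)) (esym (tensA Y X Z))
    (iso_comp (xi (X ⊗ Z) Y)
      (@iso_cast D _ _ _ _ erefl (esym (tensA X Z Y))
        (iso_fmap (Aff_in C) (iso_tens (iso_id X) (braid Y Z))))).

(** [1_Z ⊗ ξ_{X,Y} = (β_{Z,Y}^-1 ⊗ 1_X) ∘ ξ_{Z⊗X,Y}] *)
Definition xi_l (Z X Y : C) : @iso D (Z ⊗ (X ⊗ Y)) (Z ⊗ (Y ⊗ X)) :=
  @iso_cast D _ _ _ _ (tensA Z X Y) (tensA Z Y X)
    (iso_comp
      (iso_fmap (Aff_in C) (iso_tens (iso_sym (braid Z Y)) (iso_id X)))
      (@iso_cast D _ _ _ _ erefl (esym (tensA Y Z X)) (xi (Z ⊗ X) Y))).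

Lemma Arrow_xi_r Z X Y :
  Arrow (xi_r Z X Y) = axi (X ⊗ Z) Y ⋆ G (atens (aid X) (abr Y Z)).
Proof. by rewrite Arrow_iso_cast Arrow_comp Arrow_iso_cast. Qed.

Lemma Arrow_xi_l Z X Y :
  Arrow (xi_l Z X Y) = G (atens (abrV Z Y) (aid X)) ⋆ axi (Z ⊗ X) Y.
Proof. by rewrite Arrow_iso_cast Arrow_comp Arrow_iso_cast. Qed.

Lemma G_eqhom (X Y : C) (e : X = Y) : G (Arrow (eqhom e)) = @aid D X.
Proof. by rewrite Arrow_eqhom afmap_id. Qed.

Lemma Arrow_fmap_eqhom (E : category) (F : functor C E) (X Y : C) (e : X = Y) :
  Arrow (fmap F (eqhom e)) = aid (F X).
Proof. by case: _ / e; rewrite /= fmap_id. Qed.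

Lemma xi_r_tens (W X Y Z : C) :
  xi_r W X (Y ⊗ Z) ≡ xi_r W (Z ⊗ X) Y
    ∘ fmap (fcomp (Aff_in C) (rtens W)) (eqhom (esym (tensA Z X Y)))
    ∘ xi_r W (X ⊗ Y) Z.
Proof.
rewrite 2!Arrow_comp 3!Arrow_xi_r Arrow_fmap_eqhom.
rewrite acomp_idr; last by composable.
rewrite abr_tensl -[aid X](acomp_idl (X := X)) // atens_comp; [|composable..].
rewrite afmap_comp; last by composable.
have := axi_nat (atens (aid X) (abr Y W)) (aid Z).
rewrite -!atens_id !atensA /= !tensA => E.
rewrite [RHS]acompA; [|composable..].
rewrite (acomp_square (esym E)); [|composable..].
rewrite axi_tens tensA -!(@acompA _ (axi _ _)) ?tensA //; composable.
Qed.

Lemma xi_r_nat (W X1 X2 Y1 Y2 : C) (f : Hom Y1 Y2) (g : Hom X1 X2) :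
  xi_r W X2 Y2 ∘ fmap (fcomp (Aff_in C) (rtens W)) (g ⊠ f)
  = fmap (fcomp (Aff_in C) (rtens W)) (f ⊠ g) ∘ xi_r W X1 Y1.
Proof.
apply: Arrow_inj; rewrite [LHS]Arrow_comp [RHS]Arrow_comp 2!Arrow_xi_r.
set a := Arrow f; set b := Arrow g.
rewrite -[X in _ ⋆ X = _]/(G (atens (atens b a) (aid W))).
rewrite -[X in _ = X ⋆ _]/(G (atens (atens a b) (aid W))).
have E1 := axi_nat (atens b (aid W)) a; rewrite /= in E1.
rewrite [LHS]acompA; [|composable..].
rewrite -afmap_comp; last by composable.
rewrite atensA -atens_comp; [|composable..].
have E2 := abr_nat a (aid W); rewrite /= in E2.
rewrite E2 acomp_idl //.
rewrite -{1}[b](acomp_idr (X := X1)) // atens_comp; [|composable..].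
rewrite afmap_comp; last by composable.
rewrite -!atensA in E1 *.
rewrite -[LHS]acompA; [|composable..].
by rewrite E1 [LHS]acompA; [|composable..].
Qed.

Definition rwhisk (W : C) : functor D D :=
  @aff_lift C D (fcomp (Aff_in C) (rtens W)) (xi_r W)
    (@xi_r_tens W) (@xi_r_nat W).

Lemma xi_l_tens (W X Y Z : C) :
  xi_l W X (Y ⊗ Z) ≡ xi_l W (Z ⊗ X) Y
    ∘ fmap (fcomp (Aff_in C) (ltens W)) (eqhom (esym (tensA Z X Y)))
    ∘ xi_l W (X ⊗ Y) Z.
Proof.
rewrite 2!Arrow_comp 3!Arrow_xi_l Arrow_fmap_eqhom.
rewrite acomp_idr; last by composable.
rewrite abrV_tensr -[aid X](acomp_idl (X := X)) // atens_comp; [|composable..].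
rewrite afmap_comp; last by composable.
have := axi_nat (atens (abrV W Z) (aid X)) (aid Y).
rewrite -!atens_id !atensA /= !tensA => E.
rewrite [RHS]acompA; [|composable..].
rewrite (acomp_square E); [|composable..].
rewrite [LHS]acompA; [|composable..].
by rewrite axi_tens !tensA.
Qed.

Lemma xi_l_nat (W X1 X2 Y1 Y2 : C) (f : Hom Y1 Y2) (g : Hom X1 X2) :
  xi_l W X2 Y2 ∘ fmap (fcomp (Aff_in C) (ltens W)) (g ⊠ f)
  = fmap (fcomp (Aff_in C) (ltens W)) (f ⊠ g) ∘ xi_l W X1 Y1.
Proof.
apply: Arrow_inj; rewrite [LHS]Arrow_comp [RHS]Arrow_comp 2!Arrow_xi_l.
set a := Arrow f; set b := Arrow g.
rewrite -[X in _ ⋆ X = _]/(G (atens (aid W) (atens b a))).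
rewrite -[X in _ = X ⋆ _]/(G (atens (aid W) (atens a b))).
have E1 := axi_nat (atens (aid W) b) a; rewrite /= in E1.
rewrite [LHS]acompA; [|composable..].
rewrite atensA in E1; rewrite E1.
rewrite -[LHS]acompA; [|composable..].
rewrite -[RHS]acompA; [|composable..].
congr (_ ⋆ _).
rewrite -!afmap_comp; [|composable..].
congr (G _).
rewrite -!atensA -!atens_comp; [|composable..].
have E2 := abrV_nat (aid W) a; rewrite /= in E2.
by rewrite E2 acomp_idl ?acomp_idr.
Qed.

Definition lwhisk (W : C) : functor D D :=
  @aff_lift C D (fcomp (Aff_in C) (ltens W)) (xi_l W)
    (@xi_l_tens W) (@xi_l_nat W).

Local Notation RW Z a := (afmap (rwhisk Z) a).
Local Notation LW Z a := (afmap (lwhisk Z) a).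

Lemma rw_in Z a : RW Z (G a) = G (atens a (aid Z)).
Proof. congr Arrow;
  exact: (@aff_lift_in C D (fcomp (Aff_in C) (rtens Z)) (xi_r Z)
    (@xi_r_tens Z) (@xi_r_nat Z)). Qed.

Lemma rw_xi Z X Y :
  RW Z (axi X Y) = axi (X ⊗ Z) Y ⋆ G (atens (aid X) (abr Y Z)).
Proof. by rewrite -Arrow_xi_r; congr Arrow;
  exact: (@aff_lift_xi C D (fcomp (Aff_in C) (rtens Z)) (xi_r Z)
    (@xi_r_tens Z) (@xi_r_nat Z)). Qed.

Lemma lw_in Z a : LW Z (G a) = G (atens (aid Z) a).
Proof. congr Arrow;
  exact: (@aff_lift_in C D (fcomp (Aff_in C) (ltens Z)) (xi_l Z)
    (@xi_l_tens Z) (@xi_l_nat Z)). Qed.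

Lemma lw_xi Z X Y :
  LW Z (axi X Y) = G (atens (abrV Z Y) (aid X)) ⋆ axi (Z ⊗ X) Y.
Proof. by rewrite -Arrow_xi_l; congr Arrow;
  exact: (@aff_lift_xi C D (fcomp (Aff_in C) (ltens Z)) (xi_l Z)
    (@xi_l_tens Z) (@xi_l_nat Z)). Qed.

Lemma aff_functor_ext (E : category) (H K : functor D E) :
  (forall a, afmap H (G a) = afmap K (G a)) ->
  (forall X Y, afmap H (axi X Y) = afmap K (axi X Y)) ->
  forall a, afmap H a = afmap K a.
Proof.
move=> HG Hxi; apply: aff_arrow_ind => //.
- move=> a b ab Ha; apply: (ainv_uniq (afmap_inv H ab)).
  by rewrite Ha; apply: afmap_inv.
- by move=> b a e Hb Ha; rewrite !afmap_comp // Ha Hb.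
Qed.

Lemma rw_rw Y Z a : RW Z (RW Y a) = RW (Y ⊗ Z) a.
Proof.
apply: (@aff_functor_ext D (fcomp (rwhisk Z) (rwhisk Y)) (rwhisk (Y ⊗ Z))) => {a}.
- move=> a; rewrite -[LHS]/(RW Z (RW Y (G a))).
  by rewrite 3!rw_in atensA atens_id.
- move=> A B; rewrite -[LHS]/(RW Z (RW Y (axi A B))).
  rewrite 2!rw_xi afmap_comp; last by composable.
  rewrite rw_xi rw_in abr_tensr.
  rewrite -{2}[aid A](acomp_idl (X := A)) // atens_comp; [|composable..].
  rewrite afmap_comp; last by composable.
  by rewrite -!atens_id !atensA tensA acompA; [|composable..].
Qed.

Lemma lw_lw X Y a : LW X (LW Y a) = LW (X ⊗ Y) a.
Proof.
apply: (@aff_functor_ext D (fcomp (lwhisk X) (lwhisk Y)) (lwhisk (X ⊗ Y))) => {a}.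
- move=> a; rewrite -[LHS]/(LW X (LW Y (G a))).
  by rewrite 3!lw_in -atensA atens_id.
- move=> A B; rewrite -[LHS]/(LW X (LW Y (axi A B))).
  rewrite 2!lw_xi afmap_comp; last by composable.
  rewrite lw_xi lw_in abrV_tensl.
  rewrite -{2}[aid A](acomp_idl (X := A)) // atens_comp; [|composable..].
  rewrite afmap_comp; last by composable.
  by rewrite -!atens_id !atensA tensA acompA; [|composable..].
Qed.

Lemma rw_lw X Z a : RW Z (LW X a) = LW X (RW Z a).
Proof.
apply: (@aff_functor_ext D (fcomp (rwhisk Z) (lwhisk X))
  (fcomp (lwhisk X) (rwhisk Z))) => {a}.
- move=> a; rewrite -[LHS]/(RW Z (LW X (G a))) -[RHS]/(LW X (RW Z (G a))).
  by rewrite (rw_in Z a) (lw_in X a) rw_in lw_in atensA.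
- move=> A B.
  rewrite -[LHS]/(RW Z (LW X (axi A B))) -[RHS]/(LW X (RW Z (axi A B))).
  rewrite rw_xi lw_xi !afmap_comp; [|composable..].
  rewrite rw_xi lw_xi rw_in lw_in.
  by rewrite -!atens_id !atensA tensA acompA; [|composable..].
Qed.

Lemma rw_unit a : RW 𝟙 a = a.
Proof.
rewrite -[RHS](_ : afmap (fid D) a = a); last by case: a.
apply: aff_functor_ext => {a} [a|A B].
  by rewrite rw_in atenso1.
by rewrite rw_xi abr_unitr atens_id afmap_id tenso1 acomp_idr.
Qed.

Lemma lw_unit a : LW 𝟙 a = a.
Proof.
rewrite -[RHS](_ : afmap (fid D) a = a); last by case: a.
apply: aff_functor_ext => {a} [a|A B].
  by rewrite lw_in atens1o.
by rewrite lw_xi abrV_unitl atens_id afmap_id tens1o acomp_idl.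
Qed.

Lemma exchange_in_xi a X Y :
  RW (Y ⊗ X) (G a) ⋆ LW (asrc a) (axi X Y) =
  LW (atgt a) (axi X Y) ⋆ RW (X ⊗ Y) (G a).
Proof.
rewrite 2!rw_in 2!lw_xi.
have E1 := axi_nat (atens a (aid X)) (aid Y); rewrite /= in E1.
have := abrV_nat a (aid Y); rewrite /= => E2.
have {}E2 : G (atens (abrV (atgt a) Y) (aid X)) ⋆ G (atens (aid Y) (atens a (aid X)))
    = G (atens a (aid (Y ⊗ X))) ⋆ G (atens (abrV (asrc a) Y) (aid X)).
  rewrite -!afmap_comp; [|composable..].
  by rewrite -atens_id -!atensA -!atens_comp ?E2 //; composable.
rewrite -(@acompA _ (G _) (G _)); [|composable..].
rewrite -E2 [LHS]acompA; [|composable..].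
rewrite -E1 -[LHS]acompA; [|composable..].
by rewrite atensA atens_id.
Qed.

Lemma exchange_xi_in b X Y :
  RW (atgt b) (axi X Y) ⋆ LW (X ⊗ Y) (G b) =
  LW (Y ⊗ X) (G b) ⋆ RW (asrc b) (axi X Y).
Proof.
rewrite 2!lw_in 2!rw_xi.
have E1 := axi_nat (atens (aid X) b) (aid Y); rewrite /= in E1.
have := abr_nat (aid Y) b; rewrite /= => E2.
have {}E2 : G (atens (aid X) (abr Y (atgt b))) ⋆ G (atens (aid (X ⊗ Y)) b)
    = G (atens (atens (aid X) b) (aid Y)) ⋆ G (atens (aid X) (abr Y (asrc b))).
  rewrite -!afmap_comp; [|composable..].
  by rewrite -atens_id !atensA -!atens_comp ?E2 //; composable.
rewrite [LHS]acompA; [|composable..].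
rewrite E2 -[LHS]acompA; [|composable..].
rewrite E1 [LHS]acompA; [|composable..].
by rewrite -atensA atens_id.
Qed.

Lemma exchange_xi_xi X Y Z W :
  RW (W ⊗ Z) (axi X Y) ⋆ LW (X ⊗ Y) (axi Z W) =
  LW (Y ⊗ X) (axi Z W) ⋆ RW (Z ⊗ W) (axi X Y).
Proof.
have [_ _ VK KV] := abr_inv Y W.
have M1 : atens (aid X) (abr Y (W ⊗ Z)) ⋆ atens (abrV (X ⊗ Y) W) (aid Z) =
    atens (abrV X W) (atens (aid Z) (aid Y)) ⋆ atens (aid W) (atens (aid X) (abr Y Z)).
  rewrite abr_tensr abrV_tensl.
  have -> : atens (aid X) (atens (aid W) (abr Y Z) ⋆ atens (abr Y W) (aid Z)) =
      atens (atens (aid X) (aid W)) (abr Y Z) ⋆ atens (atens (aid X) (abr Y W)) (aid Z).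
    by rewrite !atensA -[in RHS]atens_comp ?acomp_idl //; composable.
  have -> : atens (atens (aid X) (abrV Y W) ⋆ atens (abrV X W) (aid Y)) (aid Z) =
      atens (atens (aid X) (abrV Y W)) (aid Z) ⋆ atens (abrV X W) (atens (aid Y) (aid Z)).
    by rewrite -[in RHS]atensA -[in RHS]atens_comp ?acomp_idl //; composable.
  rewrite acompA; [|composable..].
  rewrite -(@acompA _ (atens (atens (aid X) (abr Y W)) (aid Z))); [|composable..].
  rewrite -atens_comp; [|composable..].
  rewrite -(atens_comp (a' := aid X)); [|composable..].
  rewrite KV !acomp_idl //= !atens_id acomp_idl; last by composable.
  rewrite -[in RHS]atensA atens_id.
  rewrite -[in LHS]atens_comp; [|composable..].
  rewrite -[in RHS]atens_comp; [|composable..].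
  by rewrite !acomp_idl ?acomp_idr //; composable.
have M2 : atens (abrV (Y ⊗ X) W) (aid Z) ⋆ atens (abr Y W) (atens (aid X) (aid Z)) =
    atens (aid Y) (atens (abrV X W) (aid Z)).
  rewrite -2!atensA -atens_comp; [|composable..].
  rewrite abrV_tensl acompA; [|composable..].
  by rewrite -atens_comp // VK !acomp_idl //= atens_id acomp_idr //; composable.
have E1 := axi_nat (atens (abrV X W) (aid Z)) (aid Y).
have E2 := axi_nat (atens (aid X) (abr Y Z)) (aid W).
have E3 := axi_nat (atens (aid X) (aid Z)) (abr Y W).
rewrite /= !atensA ?tensA in E1 E2 E3.
have T1 := axi_tens (X ⊗ Z) Y W; have T2 := axi_tens (X ⊗ Z) W Y.
rewrite ?tensA in T1 T2.
have M3 : atens (aid X) (abr Y (Z ⊗ W)) =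
    atens (aid X) (atens (aid Z) (abr Y W)) ⋆ atens (aid X) (atens (abr Y Z) (aid W)).
  by rewrite abr_tensr -[in RHS]atens_comp ?acomp_idl //; composable.
rewrite !rw_xi !lw_xi !tensA.
rewrite acompA; [|composable..].
rewrite -(@acompA _ (G _) (G _)); [|composable..].
rewrite -afmap_comp; last by composable.
rewrite M1 afmap_comp; last by composable.
rewrite (@acompA _ (G _) (G _)); [|composable..].
rewrite -E2 (acomp_square E1); [|composable..].
rewrite -(@acompA _ (axi _ _) (axi _ _)); [|composable..].
rewrite -T1.
rewrite [RHS]acompA; [|composable..].
rewrite -(@acompA _ (axi _ _) (axi _ _)); [|composable..].
rewrite -T2 M3 afmap_comp; last by composable.
rewrite (acomp_square E3); [|composable..].
rewrite -(@acompA _ (G _) (G _)); [|composable..].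
by rewrite -afmap_comp ?M2 //; composable.
Qed.

Local Definition exchange (a b : arrow D) :=
  RW (atgt b) a ⋆ LW (asrc a) b = LW (atgt a) b ⋆ RW (asrc b) a.

Lemma exchange_comp_l (a a' b : arrow D) : atgt a = asrc a' ->
  exchange a' b -> exchange a b -> exchange (a' ⋆ a) b.
Proof.
rewrite /exchange => e E' E; rewrite atgt_comp asrc_comp // !afmap_comp //.
rewrite acompA /= ?e // E e -acompA /= ?e // E' acompA //= e //.
Qed.

Lemma exchange_comp_r (a b b' : arrow D) : atgt b = asrc b' ->
  exchange a b' -> exchange a b -> exchange a (b' ⋆ b).
Proof.
rewrite /exchange => e E' E; rewrite atgt_comp asrc_comp // !afmap_comp //.
rewrite -acompA /= ?e // E' acompA //= ?e // -e E acompA //= e //.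
Qed.

Lemma exchange_inv_l (a a' b : arrow D) :
  ainv a a' -> exchange a b -> exchange a' b.
Proof.
move=> aa E; have [a1 a2 _ _] := aa.
have := ainv_square (afmap_inv (rwhisk (atgt b)) aa)
  (afmap_inv (rwhisk (asrc b)) aa) _ _ _ _ E.
by rewrite /exchange -a1 a2 => <-.
Qed.

Lemma exchange_inv_r (a b b' : arrow D) :
  ainv b b' -> exchange a b -> exchange a b'.
Proof.
move=> bb E; have [b1 b2 _ _] := bb.
have := ainv_square (afmap_inv (lwhisk (atgt a)) bb)
  (afmap_inv (lwhisk (asrc a)) bb) _ _ _ _ (esym E).
by rewrite /exchange -b1 b2 => <-.
Qed.

Lemma whisk_exchange (a b : arrow D) : exchange a b.
Proof.
elim/aff_arrow_ind: b => [b|Z W|b b' bb' IH|b' b e IHb' IHb]; last 2 first.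
- exact: exchange_inv_r IH.
- exact: exchange_comp_r.
- elim/aff_arrow_ind: a => [a|X Y|a a' aa' IH|a' a e IHa' IHa].
  + rewrite /exchange 2!rw_in 2!lw_in -!afmap_comp; [|composable..].
    by rewrite -!atens_comp ?acomp_idl ?acomp_idr.
  + exact: exchange_xi_in.
  + exact: exchange_inv_l IH.
  + exact: exchange_comp_l.
- elim/aff_arrow_ind: a => [a|X Y|a a' aa' IH|a' a e IHa' IHa].
  + exact: exchange_in_xi.
  + exact: exchange_xi_xi.
  + exact: exchange_inv_l IH.
  + exact: exchange_comp_l.
Qed.

Definition aff_tensm (X X' Y Y' : D) (f : Hom X X') (g : Hom Y Y') :
    @Hom D (X ⊗ Y) (X' ⊗ Y') :=
  fmap (rwhisk Y') f ∘ fmap (lwhisk X) g.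

Lemma Arrow_aff_tensm (X X' Y Y' : D) (f : Hom X X') (g : Hom Y Y') :
  Arrow (aff_tensm f g) = RW Y' (Arrow f) ⋆ LW X (Arrow g).
Proof. exact: Arrow_comp. Qed.

Lemma aff_tensm_id (X Y : D) :
  aff_tensm (idm X) (idm Y) = @idm D (tens X Y).
Proof. by rewrite /aff_tensm !fmap_id comp_idl. Qed.

Lemma aff_tensm_comp (X X' X'' Y Y' Y'' : D)
    (f' : Hom X' X'') (f : Hom X X') (g' : Hom Y' Y'') (g : Hom Y Y') :
  aff_tensm (f' ∘ f) (g' ∘ g) = aff_tensm f' g' ∘ aff_tensm f g.
Proof.
apply: Arrow_inj; rewrite [RHS]Arrow_comp !Arrow_aff_tensm.
rewrite !(@Arrow_comp D) !afmap_comp //.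
have E := whisk_exchange (Arrow f) (Arrow g'); rewrite /exchange /= in E.
rewrite [LHS]acompA; [|composable..].
rewrite (acomp_square E); [|composable..].
by rewrite [RHS]acompA; [|composable..].
Qed.

Lemma aff_tensmA (X X' Y Y' Z Z' : D)
    (f : Hom X X') (g : Hom Y Y') (h : Hom Z Z') :
  aff_tensm (aff_tensm f g) h ≡ aff_tensm f (aff_tensm g h).
Proof.
rewrite !Arrow_aff_tensm !afmap_comp // rw_rw -lw_lw rw_lw.
by rewrite acompA //=; composable.
Qed.

Lemma aff_tensm1o (X X' : D) (f : Hom X X') :
  aff_tensm (@idm D (𝟙 : C)) f ≡ f.
Proof.
rewrite Arrow_aff_tensm lw_unit -/(@aid D _) afmap_id acomp_idl //=.
by rewrite tens1o.
Qed.

Lemma aff_tensmo1 (X X' : D) (f : Hom X X') :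
  aff_tensm f (@idm D (𝟙 : C)) ≡ f.
Proof.
rewrite Arrow_aff_tensm rw_unit -/(@aid D _) afmap_id acomp_idr //=.
by rewrite tenso1.
Qed.

Definition Aff : strict_monoidal :=
  @StrictMonoidal D (fun X Y : C => X ⊗ Y) (𝟙 : C) aff_tensm aff_tensm_id
    aff_tensm_comp (@tensA C) (@tens1o C) (@tenso1 C)
    aff_tensmA aff_tensm1o aff_tensmo1.

(** [aff_in_tens], [xi_tens_id] and [id_tens_xi] are the equations that
    determine the tensor product of [Aff]. *)
Lemma aff_in_tens (X X' Y Y' : C) (f : Hom X X') (g : Hom Y Y') :
  aff_in (f ⊠ g) = (aff_in f : @Hom Aff X X') ⊠ (aff_in g : @Hom Aff Y Y').
Proof.
apply: Arrow_inj; rewrite [RHS]Arrow_aff_tensm.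
rewrite -[Arrow (aff_in f)]/(G (Arrow f)) -[Arrow (aff_in g)]/(G (Arrow g)).
rewrite rw_in lw_in -afmap_comp; last by composable.
by rewrite -atens_comp // acomp_idl // acomp_idr.
Qed.

Lemma xi_tens_id (X Y Z : C) :
  (xi X Y : @Hom Aff (X ⊗ Y) (Y ⊗ X)) ⊠ (@idm Aff Z) ≡
    xi (X ⊗ Z) Y ∘ @eqhom Aff _ _ (esym (tensA X Z Y))
      ∘ aff_in (idm X ⊠ braid Y Z).
Proof.
rewrite [LHS]Arrow_aff_tensm -/(@aid D _) afmap_id acomp_idr; last by composable.
rewrite [LHS]rw_xi 2!(@Arrow_comp D) Arrow_eqhom acomp_idr //=.
by rewrite tensA.
Qed.

Lemma id_tens_xi (X Y Z : C) :
  (@idm Aff X) ⊠ (xi Y Z : @Hom Aff (Y ⊗ Z) (Z ⊗ Y)) ≡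
    aff_in ((braid X Z)^-1 ⊠ idm Y) ∘ @eqhom Aff _ _ (esym (tensA Z X Y))
      ∘ xi (X ⊗ Y) Z.
Proof.
rewrite [LHS]Arrow_aff_tensm -/(@aid D _) afmap_id acomp_idl; last by composable.
rewrite [LHS]lw_xi 2!(@Arrow_comp D) Arrow_eqhom acomp_idr //=.
by rewrite tensA.
Qed.

End AffMonoidal.

Section EndCategory.
Variable M : category.

Lemma nt_id_nat (F : functor M M) (X Y : M) (f : Hom X Y) :
  idm (F Y) ∘ fmap F f = fmap F f ∘ idm (F X).
Proof. by rewrite comp_idl comp_idr. Qed.

Definition nt_id (F : functor M M) : nattrans F F :=
  NatTrans (nt_id_nat F).

Lemma nt_comp_nat (F G H : functor M M) (b : nattrans G H) (a : nattrans F G)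
    (X Y : M) (f : Hom X Y) :
  (b Y ∘ a Y) ∘ fmap F f = fmap H f ∘ (b X ∘ a X).
Proof. by rewrite -compA ncomp_nat !compA ncomp_nat. Qed.

Definition nt_comp (F G H : functor M M) (b : nattrans G H) (a : nattrans F G) :
    nattrans F H :=
  NatTrans (nt_comp_nat b a).

Lemma nt_comp_idl (F G : functor M M) (a : nattrans F G) :
  nt_comp (nt_id G) a = a.
Proof. by apply: nattrans_eq => X /=; rewrite comp_idl. Qed.

Lemma nt_comp_idr (F G : functor M M) (a : nattrans F G) :
  nt_comp a (nt_id F) = a.
Proof. by apply: nattrans_eq => X /=; rewrite comp_idr. Qed.

Lemma nt_compA (F G H K : functor M M)
    (c : nattrans H K) (b : nattrans G H) (a : nattrans F G) :
  nt_comp c (nt_comp b a) = nt_comp (nt_comp c b) a.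
Proof. by apply: nattrans_eq => X /=; rewrite compA. Qed.

Definition End_cat : category := Category nt_comp_idl nt_comp_idr nt_compA.

Lemma nt_tens_nat (F F' G G' : functor M M)
    (a : nattrans F F') (b : nattrans G G') (X Y : M) (f : Hom X Y) :
  (a (G' Y) ∘ fmap F (b Y)) ∘ fmap (fcomp F G) f =
  fmap (fcomp F' G') f ∘ (a (G' X) ∘ fmap F (b X)).
Proof.
rewrite /= -compA -fmap_comp ncomp_nat fmap_comp !compA.
by rewrite -fmap_comp ncomp_nat fmap_comp -!compA ncomp_nat.
Qed.

Definition nt_tens (F F' G G' : functor M M)
    (a : nattrans F F') (b : nattrans G G') :
    nattrans (fcomp F G) (fcomp F' G') :=
  @NatTrans _ _ (fcomp F G) (fcomp F' G')
    (fun X => a (G' X) ∘ fmap F (b X)) (nt_tens_nat a b).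

Lemma nt_tens_id (F G : functor M M) :
  nt_tens (nt_id F) (nt_id G) = nt_id (fcomp F G).
Proof. by apply: nattrans_eq => X /=; rewrite fmap_id comp_idl. Qed.

Lemma nt_tens_comp (F F' F'' G G' G'' : functor M M)
    (a' : nattrans F' F'') (a : nattrans F F')
    (b' : nattrans G' G'') (b : nattrans G G') :
  nt_tens (nt_comp a' a) (nt_comp b' b) =
  nt_comp (nt_tens a' b') (nt_tens a b).
Proof.
apply: nattrans_eq => X /=; rewrite fmap_comp !compA; congr (_ ∘ _).
by rewrite -!compA ncomp_nat.
Qed.

Lemma nattrans_Arrow_eq (F F' G G' : functor M M)
    (a : nattrans F G) (b : nattrans F' G') :
  F = F' -> G = G' -> (forall X, a X ≡ b X) ->
  @Arrow End_cat F G a = @Arrow End_cat F' G' b.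
Proof.
move=> eF eG; case: _ / eF b => b; case: _ / eG b => b E.
by congr Arrow; apply: nattrans_eq => X; apply: Arrow_inj.
Qed.

Lemma End_tensA (F G H : functor M M) :
  fcomp (fcomp F G) H = fcomp F (fcomp G H).
Proof. exact: functor_eq. Qed.

Lemma End_tens1o (F : functor M M) : fcomp (fid M) F = F.
Proof. exact: functor_eq. Qed.

Lemma End_tenso1 (F : functor M M) : fcomp F (fid M) = F.
Proof. exact: functor_eq. Qed.

Lemma End_tensmA (F F' G G' H H' : functor M M)
    (a : nattrans F F') (b : nattrans G G') (c : nattrans H H') :
  @Arrow End_cat _ _ (nt_tens (nt_tens a b) c) =
  @Arrow End_cat _ _ (nt_tens a (nt_tens b c)).
Proof.
apply: nattrans_Arrow_eq; try exact: End_tensA.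
by move=> X /=; rewrite fmap_comp compA.
Qed.

Lemma End_tensm1o (F F' : functor M M) (a : nattrans F F') :
  @Arrow End_cat _ _ (nt_tens (nt_id (fid M)) a) = @Arrow End_cat _ _ a.
Proof.
apply: nattrans_Arrow_eq; try exact: End_tens1o.
by move=> X /=; rewrite comp_idl.
Qed.

Lemma End_tensmo1 (F F' : functor M M) (a : nattrans F F') :
  @Arrow End_cat _ _ (nt_tens a (nt_id (fid M))) = @Arrow End_cat _ _ a.
Proof.
apply: nattrans_Arrow_eq; try exact: End_tenso1.
by move=> X /=; rewrite fmap_id comp_idr.
Qed.

Definition End : strict_monoidal :=
  @StrictMonoidal End_cat (fun F G => fcomp F G) (fid M) nt_tens nt_tens_id
    nt_tens_comp End_tensA End_tens1o End_tenso1
    End_tensmA End_tensm1o End_tensmo1.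

End EndCategory.

Definition action (D : strict_monoidal) (M : category) : Type :=
  monoidal_functor D (End M).

Section Actions.
Variables (D : strict_monoidal) (M : category) (A : action D M).

Definition act_functor (X : D) : functor M M := A X.

Definition act_nat (X Y : D) (f : Hom X Y) :
    nattrans (act_functor X) (act_functor Y) := fmap A f.

Definition act_ob (X : D) (N : M) : M := act_functor X N.

Definition act_hom (X Y : D) (f : Hom X Y) (N P : M) (g : Hom N P) :
    Hom (act_ob X N) (act_ob Y P) :=
  act_nat f P ∘ fmap (act_functor X) g.

(** [X · (Y · N) -> (X ⊗ Y) · N] and [N -> 𝟙 · N], components of the
    structure isomorphisms of [A]. *)
Definition act_mu (X Y : D) (N : M) :
    Hom (act_ob X (act_ob Y N)) (act_ob (X ⊗ Y) N) :=
  (iso_hom (mu A X Y) : nattrans (fcomp (act_functor X) (act_functor Y)) _) N.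

Definition act_eta (N : M) : Hom N (act_ob 𝟙 N) :=
  (iso_hom (eta A) : nattrans (fid M) (act_functor 𝟙)) N.

End Actions.

(* Main.v *)
From mathcomp Require Import all_boot boolp.
Require Import Defs.

Set Implicit Arguments.
Unset Strict Implicit.
Unset Printing Implicit Defensive.

Local Open Scope cat_scope.

(** The monoidal category [Aff C] is generated over [C] by the automorphisms
    [ξ_X] alone: from [1_X ⊗ ξ_Y = β_{X,Y}^-1 ∘ ξ_{X,Y}] one gets
    [ξ_{X,Y} = β_{X,Y} ∘ (1_X ⊗ ξ_Y)].  So a strong monoidal functor on [Aff C]
    is determined by its restriction [G] to [C] and by the automorphisms [t_X]
    to which it sends [ξ_X] ([Aff_monoidal_functor_eq]).  This gives uniqueness,
    since the formulas prescribe both, the endofunctors [A X] being recovered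
    from the action of identities.

    Conversely, a family of automorphisms [t_X] of [G X] extends [G] to [Aff C]
    as soon as ([ext_monoidal])
    - [t] is natural on [C],
    - [t] is monoidal, i.e. [t_{X⊗Y} = (t_X ⊗ 1) ∘ (1 ⊗ t_Y)],
    - [t_X ⊗ 1_Y = β_{Y,X} ∘ (1_Y ⊗ t_X) ∘ β_{X,Y}],
    up to the structure isomorphisms of [G].  One sends [ξ_{X,Y}] to
    [β_{X,Y} ∘ (1_X ⊗ t_Y)].  Its naturality is that of [t].  In the relation for
    [ξ_{X,Y⊗Z}], moving [t_Y] across [β_{X,Z}] on one side and rewriting
    [t_{Y⊗Z}] with the last two conditions on the other reduces everything to
    [β_{X,Y⊗Z} ∘ (1 ⊗ β_{Z,Y}) = β_{Z⊗X,Y} ∘ (β_{X,Z} ⊗ 1)], which is a hexagon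
    and naturality of [β].  Compatibility with the tensor product is checked on
    [ξ_{X,Y} ⊗ 1] and [1 ⊗ ξ_{X,Y}], by the hexagons and the third condition.

    For the action, [G] sends [X] to the endofunctor [F X ⊗ -], and [t_X] has
    components [T_{A,N} = β_{N,A} ∘ (1 ⊗ θ_A) ∘ β_{A,N}] with [A = F X]: the
    strand [A] goes around [N] and is twisted once.  The third condition is the
    hexagon for [T_{A,B⊗N}] ([encircle_braid]).  The second one is where the
    balancing enters: its axiom says [θ_{A⊗N} = T_{A,N} ∘ (1 ⊗ θ_N)], so that
    [T_{A⊗B,N} = T_{A,B⊗N} ∘ (1 ⊗ T_{B,N})], both sides becoming [θ_{A⊗B⊗N}]
    after composition with [1 ⊗ θ_N] ([encircle_tens]). *)

(** * Isomorphisms and tensor products of arrows *)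

Lemma iso_epi (D : category) (X Y Z : D) (i : iso X Y) (p q : Hom Y Z) :
  p ∘ i = q ∘ i -> p = q.
Proof.
move=> e; rewrite -[p]comp_idr -[q]comp_idr -(iso_invK i).
by rewrite !compA e.
Qed.

Lemma ainv_epi (C : category) (p q i j : arrow C) : ainv i j ->
  atgt i = asrc p -> atgt i = asrc q -> p ⋆ i = q ⋆ i -> p = q.
Proof.
move=> [i1 i2 i3 i4] ip iq E.
rewrite -[p](acomp_idr (X := asrc j)) -?i1 //.
rewrite -[q](acomp_idr (X := asrc j)) -?i1 //.
by rewrite i1 -i4 -!acompA ?E ?i2.
Qed.

Lemma ainv_atens (E : strict_monoidal) (a a' b b' : arrow E) :
  ainv a a' -> ainv b b' -> ainv (atens a b) (atens a' b').
Proof.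
move=> [a1 a2 a3 a4] [b1 b2 b3 b4]; split; rewrite /= ?a1 ?a2 ?b1 ?b2 //.
  by rewrite -atens_comp // a3 b3 atens_id.
by rewrite -atens_comp // a4 b4 atens_id.
Qed.

Lemma atens_idcomp (E : strict_monoidal) (X : E) (b a : arrow E) :
  atgt a = asrc b ->
  atens (aid X) (b ⋆ a) = atens (aid X) b ⋆ atens (aid X) a.
Proof. by move=> e; rewrite -atens_comp // acomp_idl. Qed.

Lemma atens_compid (E : strict_monoidal) (X : E) (b a : arrow E) :
  atgt a = asrc b ->
  atens (b ⋆ a) (aid X) = atens b (aid X) ⋆ atens a (aid X).
Proof. by move=> e; rewrite -atens_comp // acomp_idl. Qed.

Ltac rassoc := do ?(rewrite acompA; [|composable..]).

(** * Whiskering along a monoidal functor *)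

Section Whiskering.
Variables (C E : strict_monoidal) (G : monoidal_functor C E).

(** [1_X ⊗ f] and [f ⊗ 1_Z] transported along [mu] to endpoints in the image of
    [G].  In this form [G] can be treated as if it were strict: functoriality,
    naturality, associativity and unit laws of whiskering hold without any
    structure isomorphism.  The bodies are locked so that rewriting with
    [Arrow_comp] does not split them. *)
Definition whiskl (X Y Y' : C) (f : Hom (G Y) (G Y')) :
    Hom (G (X ⊗ Y)) (G (X ⊗ Y')) :=
  locked (mu G X Y' ∘ (idm (G X) ⊠ f) ∘ (mu G X Y)^-1).

Definition whiskr (Z X X' : C) (f : Hom (G X) (G X')) :
    Hom (G (X ⊗ Z)) (G (X' ⊗ Z)) :=
  locked (mu G X' Z ∘ (f ⊠ idm (G Z)) ∘ (mu G X Z)^-1).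

Lemma whiskl_mu X Y Y' (f : Hom (G Y) (G Y')) :
  whiskl X f ∘ mu G X Y = mu G X Y' ∘ (idm (G X) ⊠ f).
Proof. by rewrite /whiskl -lock -compA iso_homK comp_idr. Qed.

Lemma whiskr_mu Z X X' (f : Hom (G X) (G X')) :
  whiskr Z f ∘ mu G X Z = mu G X' Z ∘ (f ⊠ idm (G Z)).
Proof. by rewrite /whiskr -lock -compA iso_homK comp_idr. Qed.

Lemma whiskl_uniq X Y Y' (f : Hom (G Y) (G Y'))
    (p : Hom (G (X ⊗ Y)) (G (X ⊗ Y'))) :
  p ∘ mu G X Y = mu G X Y' ∘ (idm (G X) ⊠ f) -> whiskl X f = p.
Proof. by rewrite /whiskl -lock => <-; rewrite -compA iso_invK comp_idr. Qed.

Lemma whiskr_uniq Z X X' (f : Hom (G X) (G X'))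
    (p : Hom (G (X ⊗ Z)) (G (X' ⊗ Z))) :
  p ∘ mu G X Z = mu G X' Z ∘ (f ⊠ idm (G Z)) -> whiskr Z f = p.
Proof. by rewrite /whiskr -lock => <-; rewrite -compA iso_invK comp_idr. Qed.

Lemma whiskl_id X Y : whiskl X (idm (G Y)) = idm (G (X ⊗ Y)).
Proof. by apply: whiskl_uniq; rewrite tensm_id comp_idl comp_idr. Qed.

Lemma whiskr_id Z X : whiskr Z (idm (G X)) = idm (G (X ⊗ Z)).
Proof. by apply: whiskr_uniq; rewrite tensm_id comp_idl comp_idr. Qed.

Lemma whiskl_comp X Y Y' Y'' (g : Hom (G Y') (G Y'')) (f : Hom (G Y) (G Y')) :
  whiskl X (g ∘ f) = whiskl X g ∘ whiskl X f.
Proof.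
apply: whiskl_uniq; rewrite -compA whiskl_mu compA whiskl_mu -compA -tensm_comp.
by rewrite comp_idl.
Qed.

Lemma whiskr_comp Z X X' X'' (g : Hom (G X') (G X'')) (f : Hom (G X) (G X')) :
  whiskr Z (g ∘ f) = whiskr Z g ∘ whiskr Z f.
Proof.
apply: whiskr_uniq; rewrite -compA whiskr_mu compA whiskr_mu -compA -tensm_comp.
by rewrite comp_idl.
Qed.

Lemma whiskl_fmap X Y Y' (f : Hom Y Y') :
  whiskl X (fmap G f) = fmap G (idm X ⊠ f).
Proof. by apply: whiskl_uniq; rewrite -(mu_nat G) fmap_id. Qed.

Lemma whiskr_fmap Z X X' (f : Hom X X') :
  whiskr Z (fmap G f) = fmap G (f ⊠ idm Z).
Proof. by apply: whiskr_uniq; rewrite -(mu_nat G) fmap_id. Qed.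

Lemma whiskr_whiskl_mu X X' Y Y' (f : Hom (G X) (G X')) (g : Hom (G Y) (G Y')) :
  whiskr Y' f ∘ whiskl X g ∘ mu G X Y = mu G X' Y' ∘ (f ⊠ g).
Proof.
rewrite -compA whiskl_mu compA whiskr_mu -compA.
by rewrite -tensm_comp comp_idl comp_idr.
Qed.

Lemma whiskl_whiskr_mu X X' Y Y' (f : Hom (G X) (G X')) (g : Hom (G Y) (G Y')) :
  whiskl X' g ∘ whiskr Y f ∘ mu G X Y = mu G X' Y' ∘ (f ⊠ g).
Proof.
rewrite -compA whiskr_mu compA whiskl_mu -compA.
by rewrite -tensm_comp comp_idl comp_idr.
Qed.

Lemma whiskl_nat X X' Y Y' (f : Hom X X') (g : Hom (G Y) (G Y')) :
  whiskl X' g ∘ fmap G (f ⊠ idm Y) = fmap G (f ⊠ idm Y') ∘ whiskl X g.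
Proof.
rewrite -!whiskr_fmap; apply: (iso_epi (i := mu G X Y)).
by rewrite whiskl_whiskr_mu whiskr_whiskl_mu.
Qed.

Definition whiskl_iso X Y Y' (i : iso (G Y) (G Y')) :
    iso (G (X ⊗ Y)) (G (X ⊗ Y')) :=
  iso_comp (mu G X Y')
    (iso_comp (iso_tens (iso_id (G X)) i) (iso_sym (mu G X Y))).

Lemma whiskl_isoE X Y Y' (i : iso (G Y) (G Y')) :
  iso_hom (whiskl_iso X i) = whiskl X i.
Proof. by rewrite /whiskl -lock /= compA. Qed.

Local Notation m X Y := (Arrow (iso_hom (mu G X Y))).
Local Notation "1_ X" := (aid X) (at level 1).

Lemma amu_assoc X Y Z :
  m (X ⊗ Y) Z ⋆ atens (m X Y) 1_(G Z) = m X (Y ⊗ Z) ⋆ atens 1_(G X) (m Y Z).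
Proof. by have := mu_assoc G X Y Z; rewrite !Arrow_comp. Qed.

Lemma awhiskl_mu X Y Y' (f : Hom (G Y) (G Y')) :
  Arrow (whiskl X f) ⋆ m X Y = m X Y' ⋆ atens 1_(G X) (Arrow f).
Proof. by rewrite -Arrow_comp whiskl_mu Arrow_comp. Qed.

Lemma awhiskr_mu Z X X' (f : Hom (G X) (G X')) :
  Arrow (whiskr Z f) ⋆ m X Z = m X' Z ⋆ atens (Arrow f) 1_(G Z).
Proof. by rewrite -Arrow_comp whiskr_mu Arrow_comp. Qed.

(** Precomposing with the threefold structure isomorphism turns the
    associativity laws [whiskl_whiskl] and [whiskl_whiskr] into associativity of
    [⊠] in [E]. *)
Lemma amu3_inv X Y Z : exists j,
  ainv (m X (Y ⊗ Z) ⋆ atens 1_(G X) (m Y Z)) j.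
Proof.
eexists; apply: ainv_comp; [|exact: (ainv_iso (mu G _ _))|by []].
by apply: ainv_atens; [exact: ainv_iso (iso_id _)|exact: ainv_iso].
Qed.

Lemma whiskl_whiskl X Y Z Z' (f : Hom (G Z) (G Z')) :
  whiskl X (whiskl Y f) ≡ whiskl (X ⊗ Y) f.
Proof.
have [j mj] := amu3_inv X Y Z; apply: (ainv_epi mj); [composable..|].
rewrite [LHS](acomp_square (awhiskl_mu _ _)); [|composable..].
rewrite -(atens_idcomp (E := E)) // awhiskl_mu atens_idcomp //.
rewrite -[LHS]acompA; [|composable..].
rewrite -!amu_assoc (acomp_square (awhiskl_mu _ _)); [|composable..].
rewrite [LHS]acompA; [|composable..].
rewrite -[in LHS]atensA atens_id -!atens_comp; [|composable..].
by rewrite !acomp_idl ?acomp_idr.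
Qed.

Lemma whiskl_whiskr X Z Y Y' (f : Hom (G Y) (G Y')) :
  whiskl X (whiskr Z f) ≡ whiskr Z (whiskl X f).
Proof.
have [j mj] := amu3_inv X Y Z; apply: (ainv_epi mj); [composable..|].
rewrite [LHS](acomp_square (awhiskl_mu _ _)); [|composable..].
rewrite -(atens_idcomp (E := E)) // awhiskr_mu atens_idcomp //.
rewrite -!amu_assoc [RHS](acomp_square (awhiskr_mu _ _)); [|composable..].
rewrite -(atens_compid (E := E)) // awhiskl_mu atens_compid //.
rewrite -[LHS]acompA; [|composable..].
rewrite -[RHS]acompA; [|composable..].
by rewrite -amu_assoc atensA.
Qed.

Lemma whiskl_unit X Y (f : Hom (G X) (G Y)) : whiskl 𝟙 f ≡ f.
Proof.
have U Z : m 𝟙 Z ⋆ atens (Arrow (eta G)) 1_(G Z) = 1_(G Z).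
  by have := mu_unitl G Z; rewrite Arrow_comp.
rewrite -[LHS](acomp_idr (X := G X)) /=; last by rewrite tens1o.
rewrite -U -acompA; [|composable..].
rewrite awhiskl_mu [LHS]acompA; [|composable..].
rewrite -[in LHS]atens_comp // acomp_idl // acomp_idr //.
rewrite -[Arrow (eta G)](acomp_idr (X := 𝟙)) //.
rewrite -[Arrow f](acomp_idl (X := G Y)) //.
rewrite atens_comp // -[LHS]acompA; [|composable..].
by rewrite U atens1o acomp_idl.
Qed.

End Whiskering.

Arguments whiskl {C E} G X {Y Y'} f.
Arguments whiskr {C E} G Z {X X'} f.
Arguments whiskl_iso {C E} G X {Y Y'} i.

(** * Extending a monoidal functor to the affinization *)

Section Extension.
Variables (C : braided) (E : strict_monoidal) (G : monoidal_functor C E).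
Variable t : forall X : C, iso (G X) (G X).
Hypothesis t_nat : forall (X Y : C) (f : Hom X Y),
  t Y ∘ fmap G f = fmap G f ∘ t X.
Hypothesis t_tens : forall X Y : C,
  t (X ⊗ Y) ∘ mu G X Y = mu G X Y ∘ (t X ⊠ t Y).
Hypothesis t_braid : forall X Y : C,
  whiskr G Y (t X) = fmap G (braid Y X) ∘ whiskl G Y (t X) ∘ fmap G (braid X Y).

(** Forced by [ξ_{X,Y} = β_{X,Y} ∘ (1_X ⊗ ξ_Y)], see [axi_xi1]. *)
Definition ext_xi (X Y : C) : iso (G (X ⊗ Y)) (G (Y ⊗ X)) :=
  iso_comp (iso_fmap G (braid X Y)) (whiskl_iso G X (t Y)).

Lemma ext_xiE X Y :
  iso_hom (ext_xi X Y) = fmap G (braid X Y) ∘ whiskl G X (t Y).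
Proof. by rewrite -whiskl_isoE. Qed.

Local Notation g a := (afmap G a).
Local Notation β := Defs.abr.
Local Notation "1_ X" := (aid X) (at level 1).
Local Notation L X f := (Arrow (whiskl G X f)).

Lemma Arrow_ext_xi X Y : Arrow (ext_xi X Y) = g (β X Y) ⋆ L X (t Y).
Proof. by rewrite ext_xiE Arrow_comp. Qed.

Lemma awhiskl_nat (a : arrow C) Y Y' (f : Hom (G Y) (G Y')) :
  L (atgt a) f ⋆ g (atens a 1_ Y) = g (atens a 1_ Y') ⋆ L (asrc a) f.
Proof. by case: a => X X' a; rewrite /afmap /= -!Arrow_comp whiskl_nat. Qed.

Lemma t_tensE X Y : iso_hom (t (X ⊗ Y)) = whiskr G Y (t X) ∘ whiskl G X (t Y).
Proof. by apply: (iso_epi (i := mu G X Y)); rewrite whiskr_whiskl_mu t_tens. Qed.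

(** Both sides have the form
    [p ∘ (1_X ⊗ 1_Z ⊗ t_Y) ∘ (1_X ⊗ β_{Y,Z}) ∘ (1_X ⊗ 1_Y ⊗ t_Z)] once [t_{Y⊗Z}]
    is expanded on the left and [t_Y] is moved across [β_{X,Z}] on the right;
    the two prefixes [p] agree by naturality of the braiding and the hexagons. *)
Lemma ext_xi_tens X Y Z :
  ext_xi X (Y ⊗ Z) ≡
    ext_xi (Z ⊗ X) Y ∘ fmap G (eqhom (esym (tensA Z X Y))) ∘ ext_xi (X ⊗ Y) Z.
Proof.
rewrite 2!Arrow_comp 3!Arrow_ext_xi Arrow_fmap_eqhom.
rewrite acomp_idr; last by composable.
rewrite t_tensE t_braid !whiskl_comp !whiskl_fmap !Arrow_comp !whiskl_whiskl.
rewrite -[Arrow (fmap G (idm X ⊠ braid Z Y))]/(g (atens 1_ X (β Z Y))).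
rewrite -[Arrow (fmap G (idm X ⊠ braid Y Z))]/(g (atens 1_ X (β Y Z))).
rewrite (abr_tensl X Y Z) afmap_comp; last by composable.
rassoc.
have N := awhiskl_nat (β X Z) (t Y); rewrite /= in N.
rewrite (acomp_square N); [|composable..].
have H : β X (Y ⊗ Z) ⋆ atens 1_ X (β Z Y) = β (Z ⊗ X) Y ⋆ atens (β X Z) 1_ Y.
  have := abr_nat 1_ X (β Z Y); rewrite /= => ->.
  rewrite abr_tensr abr_tensl [RHS]acompA ?atensA //; composable.
have {}H := congr1 (fun a => g a) H; rewrite !afmap_comp in H; [|composable..].
by rewrite (acomp_square H); [|composable..].
Qed.

Lemma ext_xi_nat (X1 X2 Y1 Y2 : C) (f : Hom Y1 Y2) (h : Hom X1 X2) :
  ext_xi X2 Y2 ∘ fmap G (h ⊠ f) = fmap G (f ⊠ h) ∘ ext_xi X1 Y1.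
Proof.
rewrite !ext_xiE [RHS]compA -fmap_comp -braid_nat fmap_comp -2!compA.
congr (_ ∘ _).
have -> : h ⊠ f = (h ⊠ idm Y2) ∘ (idm X1 ⊠ f).
  by rewrite -tensm_comp comp_idl comp_idr.
rewrite fmap_comp compA whiskl_nat -!compA; congr (_ ∘ _).
by rewrite -whiskl_fmap -!whiskl_comp t_nat.
Qed.

Definition ext_functor : functor (Aff_cat C) E :=
  aff_lift ext_xi_tens ext_xi_nat.

Local Notation H := ext_functor.

Lemma ext_in a : afmap H (afmap (Aff_in C) a) = g a.
Proof. by congr Arrow; apply: (aff_lift_in ext_xi_tens ext_xi_nat). Qed.

Lemma ext_axi X Y : afmap H (axi X Y) = g (β X Y) ⋆ L X (t Y).
Proof.
rewrite -Arrow_ext_xi; congr Arrow.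
exact: (aff_lift_xi ext_xi_tens ext_xi_nat).
Qed.

Lemma ext_whiskr_comp Z (X Y W : Aff_cat C) (b : Hom Y W) (a : Hom X Y) :
  whiskr G Z (fmap H (b ∘ a)) = whiskr G Z (fmap H b) ∘ whiskr G Z (fmap H a).
Proof. by rewrite -whiskr_comp fmap_comp. Qed.

Lemma ext_whiskr_id Z (X : Aff_cat C) :
  whiskr G Z (fmap H (idm X)) = idm (G (X ⊗ Z : C)).
Proof. by rewrite fmap_id whiskr_id. Qed.

(** Whiskering the extension in [E] is a functor on [Aff_cat C], so that it can be
    compared on generators with the whiskering in [Aff C] that defines the
    tensor product there. *)
Definition ext_whiskr Z : functor (Aff_cat C) E :=
  @Functor (Aff_cat C) E (fun X : C => G (X ⊗ Z))
   (fun X Y f => whiskr G Z (fmap H f))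
   (@ext_whiskr_id Z) (@ext_whiskr_comp Z).

Lemma ext_whiskl_comp X (Y Z W : Aff_cat C) (b : Hom Z W) (a : Hom Y Z) :
  whiskl G X (fmap H (b ∘ a)) = whiskl G X (fmap H b) ∘ whiskl G X (fmap H a).
Proof. by rewrite -whiskl_comp fmap_comp. Qed.

Lemma ext_whiskl_id X (Y : Aff_cat C) :
  whiskl G X (fmap H (idm Y)) = idm (G (X ⊗ Y : C)).
Proof. by rewrite fmap_id whiskl_id. Qed.

Definition ext_whiskl X : functor (Aff_cat C) E :=
  @Functor (Aff_cat C) E (fun Y : C => G (X ⊗ Y))
   (fun Y Z f => whiskl G X (fmap H f))
   (@ext_whiskl_id X) (@ext_whiskl_comp X).

(** On [ξ_{X,Y}] this is [(β_{X,Y} ⊗ 1) ∘ (1_X ⊗ (t_Y ⊗ 1_Z))] against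
    [β_{X⊗Z,Y} ∘ (1 ⊗ t_Y) ∘ (1_X ⊗ β_{Y,Z})]: the expression of [t_Y ⊗ 1_Z] by
    [1_Z ⊗ t_Y] makes them equal up to a hexagon. *)
Lemma ext_rwhisk Z a : afmap H (afmap (rwhisk Z) a) = afmap (ext_whiskr Z) a.
Proof.
apply: (@aff_functor_ext C E (fcomp H (rwhisk Z)) (ext_whiskr Z)) => {a}.
- move=> a; rewrite -[LHS]/(afmap H (afmap (rwhisk Z) (afmap (Aff_in C) a))).
  rewrite rw_in ext_in.
  have -> : afmap (ext_whiskr Z) (afmap (Aff_in C) a) =
      Arrow (whiskr G Z (fmap G (ahom a))).
    congr Arrow; congr (whiskr G Z _).
    exact: (aff_lift_in ext_xi_tens ext_xi_nat).
  by rewrite whiskr_fmap.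
move=> X Y; rewrite -[LHS]/(afmap H (afmap (rwhisk Z) (axi X Y))).
rewrite rw_xi afmap_comp; last by composable.
rewrite ext_axi ext_in.
have -> : afmap (ext_whiskr Z) (axi X Y) = Arrow (whiskr G Z (ext_xi X Y)).
  by congr Arrow; congr (whiskr G Z _); apply: (aff_lift_xi ext_xi_tens ext_xi_nat).
rewrite ext_xiE whiskr_comp whiskr_fmap Arrow_comp -whiskl_whiskr t_braid.
rewrite !whiskl_comp !whiskl_fmap !Arrow_comp whiskl_whiskl.
rewrite abr_tensl afmap_comp; last by composable.
by rassoc.
Qed.

Lemma ext_lwhisk X a : afmap H (afmap (lwhisk X) a) = afmap (ext_whiskl X) a.
Proof.
apply: (@aff_functor_ext C E (fcomp H (lwhisk X)) (ext_whiskl X)) => {a}.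
- move=> a; rewrite -[LHS]/(afmap H (afmap (lwhisk X) (afmap (Aff_in C) a))).
  rewrite lw_in ext_in.
  have -> : afmap (ext_whiskl X) (afmap (Aff_in C) a) =
      Arrow (whiskl G X (fmap G (ahom a))).
    congr Arrow; congr (whiskl G X _).
    exact: (aff_lift_in ext_xi_tens ext_xi_nat).
  by rewrite whiskl_fmap.
move=> Y Z; rewrite -[LHS]/(afmap H (afmap (lwhisk X) (axi Y Z))).
rewrite lw_xi afmap_comp; last by composable.
rewrite ext_axi ext_in.
have -> : afmap (ext_whiskl X) (axi Y Z) = Arrow (whiskl G X (ext_xi Y Z)).
  by congr Arrow; congr (whiskl G X _); apply: (aff_lift_xi ext_xi_tens ext_xi_nat).
rewrite ext_xiE whiskl_comp whiskl_fmap Arrow_comp whiskl_whiskl.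
rewrite abr_tensl afmap_comp; last by composable.
rassoc.
have [_ _ VK _] := abr_inv X Z.
rewrite -[LHS]acompA; [|composable..].
rewrite -[in LHS]afmap_comp; [|composable..].
rewrite -atens_comp // VK acomp_idl //= atens_id afmap_id.
by rewrite acomp_idl //; composable.
Qed.

(** In [Aff C], [f ⊗ h] is [(f ⊗ 1) ∘ (1 ⊗ h)], so the two whiskerings suffice. *)
Lemma ext_mu_nat (X X' Y Y' : Aff C) (f : Hom X X') (h : Hom Y Y') :
  mu G X' Y' ∘ (fmap H f ⊠ fmap H h) =
  fmap H (f ⊠ h : @Hom (Aff C) _ _) ∘ (mu G X Y : Hom _ (H (X ⊗ Y))).
Proof.
rewrite -whiskr_whiskl_mu; congr (_ ∘ _).
rewrite -[@tensm (Aff C) _ _ _ _ f h]/(aff_tensm f h) /aff_tensm fmap_comp.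
congr (_ ∘ _); apply: Arrow_inj.
- exact/esym/(ext_rwhisk Y' (Arrow f)).
- exact/esym/(ext_lwhisk X (Arrow h)).
Qed.

Definition ext_monoidal : monoidal_functor (Aff C) E :=
  @MonoidalFunctor (Aff C) E H (mu G) (eta G) ext_mu_nat
    (@mu_assoc _ _ G) (@mu_unitl _ _ G) (@mu_unitr _ _ G).

Lemma ext_xi1 X : fmap ext_monoidal (xi1 X) = t X.
Proof.
apply: Arrow_inj.
rewrite -[LHS]/(afmap H (Arrow (xi1 X))) /xi1 Arrow_iso_cast ext_axi abr_unitl.
rewrite afmap_id acomp_idl; last by composable.
exact: whiskl_unit.
Qed.

End Extension.

(** * Uniqueness of the extension *)

Lemma iso_eq (C : category) (X Y : C) (i j : iso X Y) :
  (i : Hom X Y) = j -> i = j.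
Proof.
case: i j => [f f' fK fVK] [g g' gK gVK] /= e; case: _ / e gK gVK => gK gVK.
have e : f' = g' by rewrite -[f']comp_idr -gVK compA fK comp_idl.
by case: _ / e gK gVK => gK gVK; congr Iso; apply: Prop_irrelevance.
Qed.

Lemma monoidal_functor_eq (C D : strict_monoidal) (H K : monoidal_functor C D) :
  (forall X, H X = K X) ->
  (forall (X Y : C) (f : Hom X Y), fmap H f ≡ fmap K f) ->
  (forall X Y, mu H X Y ≡ mu K X Y) -> eta H ≡ eta K -> H = K.
Proof.
move=> eo ef; have {eo ef} := functor_eq eo ef.
case: H K => [H m e n a l r] [K m' e' n' a' l' r'] /= eHK.
case: _ / eHK m' e' n' a' l' r' => m' e' n' a' l' r' em ee.
have {}em : m = m'.
  do 2![apply: functional_extensionality_dep => ?].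
  exact/iso_eq/Arrow_inj.
have {}ee : e = e' by exact/iso_eq/Arrow_inj.
case: _ / em n' a' l' r' => n' a' l' r'; case: _ / ee l' r' => l' r'.
by congr MonoidalFunctor; apply: Prop_irrelevance.
Qed.

Section Uniqueness.
Variables (C : braided) (E : strict_monoidal).

Local Notation "1_ X" := (aid X) (at level 1).
Local Notation β := Defs.abr.
Local Notation i a := (afmap (Aff_in C) a).

Lemma Arrow_xi1 X : Arrow (xi1 X) = axi 𝟙 X :> arrow (Aff C).
Proof. exact: (@Arrow_iso_cast (Aff_cat C)). Qed.

(** The automorphisms [ξ_Y] generate [Aff C] over [C] as a monoidal category. *)
Lemma axi_xi1 (X Y : C) :
  axi X Y = i (β X Y) ⋆ Arrow (@idm (Aff C) X ⊠ (xi1 Y : @Hom (Aff C) Y Y)).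
Proof.
rewrite [X in _ ⋆ X]Arrow_aff_tensm.
rewrite -[Arrow (@idm (Aff C) X)]/(@aid (Aff_cat C) X).
rewrite afmap_id acomp_idl; last by composable.
rewrite Arrow_xi1 lw_xi atenso1 tenso1 -[RHS]acompA; [|composable..].
have [_ _ _ KV] := abr_inv X Y.
by rewrite -afmap_comp // KV afmap_id acomp_idl.
Qed.

Lemma Arrow_whiskl (G : monoidal_functor (Aff C) E) X Y Y' (f : Hom (G Y) (G Y')) :
  Arrow (whiskl G X f) =
    Arrow (mu G X Y') ⋆ atens 1_(G X) (Arrow f) ⋆ Arrow (mu G X Y)^-1.
Proof. by rewrite /whiskl -lock !Arrow_comp. Qed.

Lemma Aff_monoidal_functor_eq (H K : monoidal_functor (Aff C) E) :
  (forall X, H X = K X) ->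
  (forall (X Y : C) (f : Hom X Y), fmap H (aff_in f) ≡ fmap K (aff_in f)) ->
  (forall X : C, fmap H (xi1 X) ≡ fmap K (xi1 X)) ->
  (forall X Y, mu H X Y ≡ mu K X Y) -> eta H ≡ eta K -> H = K.
Proof.
move=> eo ein exi emu eeta.
have emuV X Y : (mu H X Y)^-1 ≡ (mu K X Y)^-1.
  by apply: ainv_uniq (ainv_iso (mu H X Y)) _; rewrite emu; apply: ainv_iso.
have lwE (G : monoidal_functor (Aff C) E) X Y : afmap G (axi X Y) =
    afmap G (i (β X Y)) ⋆ Arrow (whiskl G X (fmap G (xi1 Y))).
  by rewrite axi_xi1 afmap_comp ?whiskl_fmap.
have ef : forall a, afmap H a = afmap K a.
  apply: (@aff_functor_ext C E H K) => [a|X Y]; first exact: ein.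
  rewrite !lwE !Arrow_whiskl exi emu emuV eo; congr (_ ⋆ _); exact: ein.
by apply: monoidal_functor_eq => // X Y f; apply: ef (Arrow f).
Qed.

End Uniqueness.

(** * A twisted strand encircling an object *)

Section Encircle.
Variable M : balanced.
Local Notation "1_ X" := (aid X) (at level 1).
Local Notation β := Defs.abr.
Local Notation θ X := (Arrow (iso_hom (twist X))).

Definition encircle (A N : M) : iso (A ⊗ N) (A ⊗ N) :=
  iso_comp (braid N A) (iso_comp (iso_tens (iso_id N) (twist A)) (braid A N)).

Local Notation T A N := (Arrow (iso_hom (encircle A N))).

Lemma aencircle A N : T A N = β N A ⋆ (atens 1_ N (θ A) ⋆ β A N).
Proof. by rewrite !Arrow_comp. Qed.

Lemma encircle_nat (A A' N N' : M) (f : Hom A A') (g : Hom N N') :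
  encircle A' N' ∘ (f ⊠ g) = (f ⊠ g) ∘ encircle A N.
Proof.
rewrite /= -!compA braid_nat [idm N' ⊠ _ ∘ _]compA -tensm_comp comp_idl.
rewrite twist_nat -[in LHS](comp_idr g) tensm_comp [RHS]compA -braid_nat.
by rewrite -!compA.
Qed.

(** The balancing axiom, with the twist of [N] slid through the first braiding. *)
Lemma twist_encircle (A N : M) :
  (twist (A ⊗ N) : Hom _ _) = encircle A N ∘ (idm A ⊠ twist N).
Proof.
rewrite twist_tens /= -!compA; congr (_ ∘ _).
by rewrite braid_nat compA -tensm_comp comp_idl comp_idr.
Qed.

Lemma atwist_encircle A N : θ (A ⊗ N) = T A N ⋆ atens 1_ A (θ N).
Proof. by rewrite -Arrow_tens -Arrow_comp twist_encircle. Qed.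

(** After composition with [1 ⊗ θ_N], both sides are the twist of [A ⊗ B ⊗ N]. *)
Lemma encircle_tens A B N : T (A ⊗ B) N = T A (B ⊗ N) ⋆ atens 1_ A (T B N).
Proof.
apply: (ainv_epi (i := atens 1_ (A ⊗ B) (θ N))).
- by apply: ainv_atens; [exact: ainv_iso (iso_id _)|exact: ainv_iso].
- composable.
- composable.
rewrite -atwist_encircle -atens_id atensA acompA; [|composable..].
by rewrite -atens_idcomp // -!atwist_encircle tensA.
Qed.

(** To go around [B ⊗ N], the strand [A] crosses [B], goes around [N], and
    crosses [B] back. *)
Lemma encircle_braid A B N :
  T A (B ⊗ N) = atens (β B A) 1_ N ⋆ (atens 1_ B (T A N) ⋆ atens (β A B) 1_ N).
Proof.
rewrite !aencircle abr_tensl abr_tensr.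
rewrite !atens_idcomp; [|composable..].
rewrite -atens_id atensA; by rassoc.
Qed.

End Encircle.

(** * The action by left tensoring *)

Section NatIso.
Variables (M : category) (F G : functor M M) (i : forall N, iso (F N) (G N)).
Hypothesis i_nat : forall (N P : M) (f : Hom N P),
  i P ∘ fmap F f = fmap G f ∘ i N.

Lemma nat_iso_inv_nat (N P : M) (f : Hom N P) :
  (i P)^-1 ∘ fmap G f = fmap F f ∘ (i N)^-1.
Proof.
apply: (iso_epi (i := i N)); rewrite -!compA -i_nat iso_homK comp_idr.
by rewrite compA iso_homK comp_idl.
Qed.

Definition nat_iso_hom : nattrans F G := NatTrans i_nat.
Definition nat_iso_inv : nattrans G F := NatTrans nat_iso_inv_nat.

Lemma nat_iso_homK : nt_comp nat_iso_inv nat_iso_hom = nt_id F.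
Proof. by apply: nattrans_eq => N; apply: iso_homK. Qed.

Lemma nat_iso_invK : nt_comp nat_iso_hom nat_iso_inv = nt_id G.
Proof. by apply: nattrans_eq => N; apply: iso_invK. Qed.

Definition nat_iso : @iso (End M) F G :=
  @Iso (End M) F G nat_iso_hom nat_iso_inv nat_iso_homK nat_iso_invK.

End NatIso.

Section LeftAction.
Variables (C : strict_monoidal) (M : braided) (F : monoidal_functor C M).
Local Notation "1_ X" := (aid X) (at level 1).
Local Notation m X Y := (Arrow (iso_hom (mu F X Y))).

Lemma lact_nat (X Y : C) (f : Hom X Y) (N P : M) (g : Hom N P) :
  (fmap F f ⊠ idm P) ∘ (idm (F X) ⊠ g) = (idm (F Y) ⊠ g) ∘ (fmap F f ⊠ idm N).
Proof. by rewrite -!tensm_comp !comp_idl !comp_idr. Qed.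

Definition lact_map (X Y : C) (f : Hom X Y) :
    nattrans (ltens (F X)) (ltens (F Y)) :=
  @NatTrans M M (ltens (F X)) (ltens (F Y))
    (fun N => fmap F f ⊠ idm N) (lact_nat f).

Lemma lact_id (X : C) : lact_map (idm X) = nt_id (ltens (F X)).
Proof. by apply: nattrans_eq => N; rewrite /= fmap_id tensm_id. Qed.

Lemma lact_comp (X Y Z : C) (g : Hom Y Z) (f : Hom X Y) :
  lact_map (g ∘ f) = nt_comp (lact_map g) (lact_map f).
Proof.
by apply: nattrans_eq => N; rewrite /= fmap_comp -tensm_comp comp_idl.
Qed.

Definition lact_functor : functor C (End M) :=
  @Functor C (End M) (fun X => ltens (F X)) lact_map lact_id lact_comp.

(** Locked, like [lact_eta_ob], so that rewriting with [Arrow_comp] does not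
    split the cast. *)
Definition lact_mu_ob (X Y : C) (N : M) :
    iso (F X ⊗ (F Y ⊗ N)) (F (X ⊗ Y) ⊗ N) :=
  locked (iso_cast (tensA _ _ _) erefl (iso_tens (mu F X Y) (iso_id N))).

Definition lact_eta_ob (N : M) : iso N (F 𝟙 ⊗ N) :=
  locked (iso_cast (tens1o N) erefl (iso_tens (eta F) (iso_id N))).

Lemma Arrow_lact_mu X Y N : Arrow (lact_mu_ob X Y N) = atens (m X Y) 1_ N.
Proof. by rewrite /lact_mu_ob -lock; apply: Arrow_iso_cast. Qed.

Lemma Arrow_lact_eta N : Arrow (lact_eta_ob N) = atens (Arrow (eta F)) 1_ N.
Proof. by rewrite /lact_eta_ob -lock; apply: Arrow_iso_cast. Qed.

Lemma lact_mu_ob_nat (X Y : C) (N P : M) (g : Hom N P) :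
  lact_mu_ob X Y P ∘ (idm (F X) ⊠ (idm (F Y) ⊠ g)) =
  (idm (F (X ⊗ Y)) ⊠ g) ∘ lact_mu_ob X Y N.
Proof.
apply: Arrow_inj; rewrite !Arrow_comp !Arrow_lact_mu !Arrow_tens -atensA.
rewrite atens_id -!atens_comp; [|composable..].
by rewrite !acomp_idl ?acomp_idr.
Qed.

Lemma lact_eta_ob_nat (N P : M) (g : Hom N P) :
  lact_eta_ob P ∘ g = (idm (F 𝟙) ⊠ g) ∘ lact_eta_ob N.
Proof.
apply: Arrow_inj; rewrite !Arrow_comp !Arrow_lact_eta !Arrow_tens.
rewrite -{1}[Arrow g]atens1o -!atens_comp; [|composable..].
by rewrite !acomp_idl ?acomp_idr.
Qed.

Definition lact_mu (X Y : C) :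
    @iso (End M) (fcomp (ltens (F X)) (ltens (F Y))) (ltens (F (X ⊗ Y))) :=
  @nat_iso M (fcomp (ltens (F X)) (ltens (F Y))) (ltens (F (X ⊗ Y)))
    (lact_mu_ob X Y) (lact_mu_ob_nat X Y).

Definition lact_eta : @iso (End M) (fid M) (ltens (F 𝟙)) :=
  @nat_iso M (fid M) (ltens (F 𝟙)) lact_eta_ob lact_eta_ob_nat.

Lemma lact_mu_nat (X X' Y Y' : C) (f : Hom X X') (g : Hom Y Y') :
  @comp (End M) _ _ _ (lact_mu X' Y')
    (@tensm (End M) _ _ _ _ (fmap lact_functor f) (fmap lact_functor g)) =
  @comp (End M) _ _ _ (fmap lact_functor (f ⊠ g)) (lact_mu X Y).
Proof.
apply: nattrans_eq => N; apply: Arrow_inj.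
rewrite -[LHS]/(Arrow (lact_mu_ob X' Y' N ∘
  ((fmap F f ⊠ idm (F Y' ⊗ N)) ∘ (idm (F X) ⊠ (fmap F g ⊠ idm N))))).
rewrite -[RHS]/(Arrow ((fmap F (f ⊠ g) ⊠ idm N) ∘ lact_mu_ob X Y N)).
rewrite -tensm_comp comp_idl comp_idr !Arrow_comp !Arrow_lact_mu !Arrow_tens.
rewrite -atensA -!atens_comp; [|composable..].
by rewrite -Arrow_tens -!Arrow_comp mu_nat.
Qed.

Lemma lact_mu_assoc (X Y Z : C) :
  @comp (End M) _ _ _ (lact_mu (X ⊗ Y) Z)
    (@tensm (End M) _ _ _ _ (lact_mu X Y) (@idm (End M) (ltens (F Z)))) ≡
  @comp (End M) _ _ _ (lact_mu X (Y ⊗ Z))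
    (@tensm (End M) _ _ _ _ (@idm (End M) (ltens (F X))) (lact_mu Y Z)).
Proof.
apply: nattrans_Arrow_eq; [exact: End_tensA|by rewrite tensA|] => N.
rewrite -[LHS]/(Arrow (lact_mu_ob (X ⊗ Y) Z N ∘
  (lact_mu_ob X Y (F Z ⊗ N) ∘ (idm (F X) ⊠ (idm (F Y) ⊠ (idm (F Z ⊗ N))))))).
rewrite -[RHS]/(Arrow (lact_mu_ob X (Y ⊗ Z) N ∘
  (idm _ ∘ (idm (F X) ⊠ lact_mu_ob Y Z N)))).
rewrite !tensm_id comp_idl comp_idr !Arrow_comp !Arrow_tens !Arrow_lact_mu.
rewrite -[in LHS]atens_id -!atensA -!atens_comp; [|composable..].
have := mu_assoc F X Y Z; rewrite !Arrow_comp !Arrow_tens => E.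
by rewrite E.
Qed.

Lemma lact_mu_unitl (X : C) :
  @comp (End M) _ _ _ (lact_mu 𝟙 X)
    (@tensm (End M) _ _ _ _ lact_eta (@idm (End M) (ltens (F X)))) ≡
  @idm (End M) (ltens (F X)).
Proof.
apply: nattrans_Arrow_eq; [exact: End_tens1o|by rewrite tens1o|] => N.
rewrite -[LHS]/(Arrow (lact_mu_ob 𝟙 X N ∘
  (lact_eta_ob (F X ⊗ N) ∘ idm (F X ⊗ N)))) -[RHS]/1_(F X ⊗ N).
rewrite comp_idr !Arrow_comp Arrow_lact_mu Arrow_lact_eta.
rewrite -[in LHS]atens_id -!atensA -!atens_comp; [|composable..].
have := mu_unitl F X; rewrite !Arrow_comp !Arrow_tens => ->.
by rewrite acomp_idl // atens_id.
Qed.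

Lemma lact_mu_unitr (X : C) :
  @comp (End M) _ _ _ (lact_mu X 𝟙)
    (@tensm (End M) _ _ _ _ (@idm (End M) (ltens (F X))) lact_eta) ≡
  @idm (End M) (ltens (F X)).
Proof.
apply: nattrans_Arrow_eq; [exact: End_tenso1|by rewrite tenso1|] => N.
rewrite -[LHS]/(Arrow (lact_mu_ob X 𝟙 N ∘
  (idm _ ∘ (idm (F X) ⊠ lact_eta_ob N)))) -[RHS]/1_(F X ⊗ N).
rewrite comp_idl !Arrow_comp Arrow_lact_mu Arrow_tens Arrow_lact_eta.
rewrite -!atensA -!atens_comp; [|composable..].
have := mu_unitr F X; rewrite !Arrow_comp !Arrow_tens => ->.
by rewrite acomp_idl // atens_id.
Qed.

Definition lact : action C M :=
  @MonoidalFunctor C (End M) lact_functor lact_mu lact_eta lact_mu_nat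
    lact_mu_assoc lact_mu_unitl lact_mu_unitr.

End LeftAction.

(** * The action by encircling *)

Section EncirclingAction.
Variables (C : braided) (M : balanced) (F : braided_functor C M).
Local Notation "1_ X" := (aid X) (at level 1).
Local Notation β := Defs.abr.
Local Notation m X Y := (Arrow (iso_hom (mu F X Y))).
Local Notation T A N := (Arrow (iso_hom (encircle A N))).
Local Notation L := (lact F).

Lemma encirclings_nat (X : C) (N P : M) (g : Hom N P) :
  encircle (F X) P ∘ (idm (F X) ⊠ g) = (idm (F X) ⊠ g) ∘ encircle (F X) N.
Proof. exact: encircle_nat. Qed.

Definition encirclings (X : C) : @iso (End M) (L X) (L X) :=
  @nat_iso M (ltens (F X)) (ltens (F X)) (encircle (F X)) (@encirclings_nat X).

Lemma encirclings_fmap (X Y : C) (f : Hom X Y) :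
  encirclings Y ∘ fmap L f = fmap L f ∘ encirclings X.
Proof. by apply: nattrans_eq => N; apply: encircle_nat. Qed.

Lemma aencircle_nat (a b : arrow M) :
  T (atgt a) (atgt b) ⋆ atens a b = atens a b ⋆ T (asrc a) (asrc b).
Proof. by rewrite -Arrow_comp encircle_nat Arrow_comp. Qed.

Lemma encirclings_tens (X Y : C) :
  encirclings (X ⊗ Y) ∘ mu L X Y = mu L X Y ∘ (encirclings X ⊠ encirclings Y).
Proof.
apply: nattrans_eq => N; apply: Arrow_inj.
rewrite -[LHS]/(Arrow (encircle (F (X ⊗ Y)) N ∘ lact_mu_ob F X Y N)).
rewrite -[RHS]/(Arrow (lact_mu_ob F X Y N ∘
  (encircle (F X) (F Y ⊗ N) ∘ (idm (F X) ⊠ encircle (F Y) N)))).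
rewrite Arrow_comp [RHS]Arrow_comp (Arrow_comp (encircle _ _)) !Arrow_lact_mu.
by rewrite [RHS]/= -encircle_tens -(aencircle_nat (m X Y) 1_ N).
Qed.

Lemma braid_lact_mu (X Y : C) (N : M) :
  Arrow (fmap F (braid X Y) ⊠ idm N) ⋆ atens (m X Y) 1_ N =
  atens (m Y X) 1_ N ⋆ atens (β (F X) (F Y)) 1_ N.
Proof.
have E : Arrow (fmap F (braid X Y)) ⋆ m X Y = m Y X ⋆ β (F X) (F Y).
  by rewrite /Defs.abr -!Arrow_comp bf_braid.
by rewrite Arrow_tens -!atens_compid ?E.
Qed.

Lemma encirclings_braid (X Y : C) :
  whiskr L Y (encirclings X) =
    fmap L (braid Y X) ∘ whiskl L Y (encirclings X) ∘ fmap L (braid X Y).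
Proof.
apply: whiskr_uniq; apply: nattrans_eq => N; apply: Arrow_inj.
(* The component at [N] of the equation that characterizes [whiskl]. *)
have lwN := congr1 (fun a : nattrans _ _ => Arrow (a N))
  (whiskl_mu (G := L) Y (encirclings X)).
set l := (whiskl L Y _ : nattrans (ltens (F (Y ⊗ X))) (ltens (F (Y ⊗ X)))) in lwN *.
have {}lwN : Arrow (l N ∘ lact_mu_ob F Y X N) =
  Arrow (lact_mu_ob F Y X N ∘ (idm _ ∘ (idm (F Y) ⊠ encircle (F X) N))) := lwN.
rewrite -[LHS]/(Arrow ((fmap F (braid Y X) ⊠ idm N) ∘ l N ∘
  (fmap F (braid X Y) ⊠ idm N) ∘ lact_mu_ob F X Y N)).
rewrite -[RHS]/(Arrow (lact_mu_ob F X Y N ∘ (encircle (F X) (F Y ⊗ N) ∘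
  (idm (F X) ⊠ idm (F Y ⊗ N))))).
rewrite comp_idl !(Arrow_comp (l N)) (Arrow_comp (lact_mu_ob _ _ _ _)) in lwN.
rewrite tensm_id comp_idr.
rewrite -2!(compA (fmap F (braid Y X) ⊠ idm N)) -(compA (l N)) [RHS]Arrow_comp.
rewrite (Arrow_comp (fmap _ _ ⊠ _)) (Arrow_comp (l N)) (Arrow_comp (fmap _ _ ⊠ _)).
rewrite !Arrow_lact_mu in lwN *.
rewrite braid_lact_mu (acomp_square lwN); [|composable..].
rewrite (acomp_square (braid_lact_mu Y X N)); [|composable..].
by rewrite -encircle_braid.
Qed.

Definition encircling_action : action (Aff C) M :=
  ext_monoidal encirclings_fmap encirclings_tens encirclings_braid.

End EncirclingAction.

(** * Comparison of actions of the affinization *)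

Lemma act_hom_idm (D : strict_monoidal) (M : category) (A : action D M)
    (X : D) (N P : M) (g : Hom N P) :
  act_hom A (idm X) g = fmap (act_functor A X) g.
Proof. by rewrite /act_hom /act_nat fmap_id; apply: comp_idl. Qed.

Lemma act_homg_idm (D : strict_monoidal) (M : category) (A : action D M)
    (X Y : D) (f : Hom X Y) (N : M) :
  act_hom A f (idm N) = act_nat A f N.
Proof. by rewrite /act_hom fmap_id comp_idr. Qed.

(** The formula for [aff_in] at identities determines the endofunctors [A X] on
    morphisms, so the values on objects of [M] need only be compared as objects. *)
Lemma Aff_action_eq (C : braided) (M : category) (A B : action (Aff C) M) :
  (forall (X : C) (N : M), act_ob A X N = act_ob B X N) ->
  (forall (X Y : C) (f : Hom X Y) (N P : M) (g : Hom N P),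
     act_hom A (aff_in f) g ≡ act_hom B (aff_in f) g) ->
  (forall (X : C) (N P : M) (g : Hom N P),
     act_hom A (xi1 X) g ≡ act_hom B (xi1 X) g) ->
  (forall (X Y : C) (N : M), act_mu A X Y N ≡ act_mu B X Y N) ->
  (forall N : M, act_eta A N ≡ act_eta B N) ->
  A = B.
Proof.
move=> eo ein exi emu eeta.
have efun (X : Aff C) : A X = B X.
  apply: (functor_eq (eo X)) => N P g.
  have := ein X X (@idm C X) N P g.
  by rewrite [aff_in _]aff_in_id !(@act_hom_idm (Aff C)).
apply: Aff_monoidal_functor_eq => [//|X Y f|X|X Y|].
- apply: nattrans_Arrow_eq => // N.
  by have := ein X Y f N N (idm N); rewrite !(@act_homg_idm (Aff C)).
- apply: nattrans_Arrow_eq => // N.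
  by have := exi X N N (idm N); rewrite !(@act_homg_idm (Aff C)).
- by apply: nattrans_Arrow_eq => [||N]; [rewrite !efun|exact: efun|exact: emu].
- by apply: nattrans_Arrow_eq.
Qed.

Section EncirclingFormulas.
Variables (C : braided) (M : balanced) (F : braided_functor C M).
Local Notation A := (encircling_action F).

Lemma encircling_in (X Y : C) (f : Hom X Y) (N P : M) (g : Hom N P) :
  act_hom A (aff_in f) g ≡ fmap F f ⊠ g.
Proof.
have E : fmap A (aff_in f) = fmap (lact F) f by apply: aff_lift_in.
congr Arrow; rewrite /act_hom /act_nat E.
by rewrite /= -tensm_comp comp_idl comp_idr.
Qed.

Lemma encircling_xi1 (X : C) (N P : M) (g : Hom N P) :
  act_hom A (xi1 X) g ≡
    braid P (F X) ∘ (g ⊠ twist (F X)) ∘ braid (F X) N.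
Proof.
congr Arrow; rewrite /act_hom /act_nat ext_xi1 /=.
by rewrite -!compA braid_nat [idm P ⊠ _ ∘ _]compA -tensm_comp comp_idl comp_idr.
Qed.

Lemma encircling_xi1V (X : C) (N P : M) (g : Hom N P) :
  act_hom A (xi1 X)^-1 g ≡
    (braid (F X) P)^-1 ∘ (g ⊠ (twist (F X))^-1) ∘ (braid N (F X))^-1.
Proof.
have E : fmap A (xi1 X)^-1 = (encirclings F X)^-1.
  have <- : iso_fmap A (xi1 X : @iso (Aff C) X X) = encirclings F X.
    by apply: iso_eq; apply: ext_xi1.
  by [].
have brV : (braid P (F X))^-1 ∘ (idm (F X) ⊠ g) = (g ⊠ idm (F X)) ∘ (braid N (F X))^-1.
  apply: (iso_epi (i := braid N (F X))).
  rewrite -!compA -braid_nat iso_homK comp_idr compA iso_homK.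
  by rewrite comp_idl.
congr Arrow; rewrite /act_hom /act_nat E /=.
by rewrite -!compA brV [(idm P ⊠ _) ∘ _]compA -tensm_comp comp_idl comp_idr.
Qed.

End EncirclingFormulas.

Theorem theorem3p2 (C : braided) (M : balanced) (F : braided_functor C M) :
  exists! A : action (Aff C) M,
    (forall (X : C) (N : M), act_ob A X N = F X ⊗ N) /\
    (forall (X Y : C) (f : Hom X Y) (N P : M) (g : Hom N P),
       act_hom A (aff_in f) g ≡ fmap F f ⊠ g) /\
    (forall (X Y : C) (N : M), act_mu A X Y N ≡ mu F X Y ⊠ idm N) /\
    (forall N : M, act_eta A N ≡ eta F ⊠ idm N) /\
    (forall (X : C) (N P : M) (g : Hom N P),
       act_hom A (xi1 X) g ≡
         braid P (F X) ∘ (g ⊠ twist (F X)) ∘ braid (F X) N) /\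
    (forall (X : C) (N P : M) (g : Hom N P),
       act_hom A (xi1 X)^-1 g ≡
         (braid (F X) P)^-1 ∘ (g ⊠ (twist (F X))^-1) ∘ (braid N (F X))^-1).
Proof.
exists (encircling_action F); split.
  split; [by []|split; [exact: encircling_in|]].
  split; [exact: Arrow_lact_mu|split; [exact: Arrow_lact_eta|]].
  by split; [exact: encircling_xi1|exact: encircling_xi1V].
move=> B [eo [ein [emu [eeta [exi _]]]]].
apply: Aff_action_eq => [X N|X Y f N P g|X N P g|X Y N|N].
- by rewrite eo.
- by rewrite ein; apply: encircling_in.
- by rewrite exi; apply: encircling_xi1.
- by rewrite emu; apply: Arrow_lact_mu.
- by rewrite eeta; apply: Arrow_lact_eta.
Qed.
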